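(* Let $s\in\{\pm 1\}^4$. Then (1) $\mathcal M_0^s(\Sigma_{0,4})$ is non-empty if and only if $s$ contains exactly two $-1$ and two $1$; (2) $\mathcal M_{1}^s(\Sigma_{0,4})$ is non-empty if and only if $s$ contains at most one $-1$; (3) $\mathcal M_{-1}^s(\Sigma_{0,4})$ is non-empty if and only if $s$ contains at most one $1$; and (4) all the non-empty spaces among those in (1), (2), (3) are connected.
   Context: $\Sigma_{0,4}$ is the oriented sphere with punctures $v_1,\dots,v_4$. A representation $\rho:\pi_1(\Sigma_{0,4})\to PSL(2,\mathbb R)$ is type-preserving if it sends every (non-trivial) peripheral element (one freely homotopic to a circle around a single puncture) to a parabolic element; it is non-elementary if its image is Zariski-dense in $PSL(2,\mathbb R)$. Every parabolic element of $PSL(2,\mathbb R)$ is conjugate, up to $\pm I$, to an upper triangular matrix with trace $2$; it is positive or negative according to the sign of the non-zero off-diagonal entry. The sign of the puncture $v_i$ for a type-preserving $\rho$ is $s(v_i)=1$ if $\rho$ sends the loop going once counterclockwise around $v_i$ to a positive parabolic element, and $s(v_i)=-1$ otherwise. Relative Euler class: $e(\rho)=\frac1{2\pi}\int_{\Sigma_{0,4}}(D_\rho)^*\omega$, where $\omega$ is the hyperbolic area form and $D_\rho:\widetilde{\Sigma_{0,4}}\to\mathbb H^2$ is a piecewise smooth $\rho$-equivariant map (pseudo-developing map) which sends each lift of a puncture to the fixed point in $\partial\mathbb H^2$ of the $\rho$-image of the corresponding peripheral subgroup. Equivalently: write $\pi_1(\Sigma_{0,4})=\langle c_1,\dots,c_4\mid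 c_1c_2c_3c_4=1\rangle$ with $c_i$ going once counterclockwise around the $i$-th puncture, let $\tilde c_i$ be the lift of $\rho(c_i)$ to the universal cover of $PSL(2,\mathbb R)$ having fixed points on the universal cover of $\partial\mathbb H^2$; then $\tilde c_1\tilde c_2\tilde c_3\tilde c_4=z^{e(\rho)}$, where $z$ is the generator of the centre given by translation by one positive full turn (a positive parabolic $w\mapsto w+1$ moves boundary points in the positive direction). $\mathcal M_k^s(\Sigma_{0,4})$ is the space of $PSL(2,\mathbb R)$-conjugacy classes of non-elementary type-preserving representations $\rho$ with $e(\rho)=k$ and signs of punctures $(s(v_1),\dots,s(v_4))=s$, with the quotient of the compact-open topology. *)

(* Defs.v *)
From HB Require Import structures.
From mathcomp Require Import all_boot all_order all_algebra.
From mathcomp Require Import all_classical all_reals all_analysis.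
From mathcomp Require mpoly.
Set Implicit Arguments.
Unset Strict Implicit.
Unset Printing Implicit Defensive.
Import Order.TTheory GRing.Theory Num.Theory.
Import numFieldNormedType.Exports.
Local Open Scope classical_set_scope.
Local Open Scope ring_scope.
Local Open Scope quotient_scope.

(* pi_1 of the four-punctured sphere: the group with the presentation
   < c_0, c_1, c_2, c_3 | c_0 c_1 c_2 c_3 = 1 >.  Its elements are words modulo
   the congruence generated by the relations; the letter (i, false) stands for
   c_i and (i, true) for its inverse. *)
Definition word : Type := seq ('I_4 * bool).

Inductive word_eq : word -> word -> Prop :=
| word_eq_refl u : word_eq u u
| word_eq_sym u v : word_eq u v -> word_eq v u
| word_eq_trans u v w : word_eq u v -> word_eq v w -> word_eq u w
| word_eq_cat u u' v v' :
    word_eq u u' -> word_eq v v' -> word_eq (u ++ v) (u' ++ v')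
| word_eq_cancel i b : word_eq [:: (i, b); (i, ~~ b)] [::]
| word_eq_relator : word_eq [seq (i, false) | i <- enum 'I_4] [::].

Definition word_eqb (u v : word) : bool := `[< word_eq u v >].

Lemma word_eqb_equiv : equiv_class_of word_eqb.
Proof.
split=> [u|u v|v u w].
- exact/asboolP/word_eq_refl.
- by apply/asboolP/asboolP; exact: word_eq_sym.
- by move=> /asboolP uv /asboolP vw; apply/asboolP; exact: word_eq_trans uv vw.
Qed.

Canonical word_equiv := EquivRelPack word_eqb_equiv.

Definition pi1 : Type := {eq_quot word_equiv}.
HB.instance Definition _ := Choice.on pi1.

Lemma pi1_eqP (u v : word) : \pi_pi1 u = \pi_pi1 v <-> word_eq u v.
Proof.
split; first by move/eqquotP/asboolP.
by move=> uv; apply/eqquotP/asboolP.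
Qed.

Lemma pi1_reprP (u : word) : word_eq (repr (\pi_pi1 u)) u.
Proof. by apply/pi1_eqP; rewrite reprK. Qed.

Definition word_inv (u : word) : word := rev [seq (x.1, ~~ x.2) | x <- u].

Lemma word_inv_cat u v : word_inv (u ++ v) = word_inv v ++ word_inv u.
Proof. by rewrite /word_inv map_cat rev_cat. Qed.

Lemma word_invK : involutive word_inv.
Proof.
move=> u; rewrite /word_inv map_rev revK -map_comp -[RHS]map_id.
by apply: eq_map => -[i b] /=; rewrite negbK.
Qed.

Lemma word_eq_mulV u : word_eq (u ++ word_inv u) [::].
Proof.
elim: u => [|[i b] u IH]; first exact: word_eq_refl.
rewrite -cat1s word_inv_cat catA -(catA _ u).
apply: (word_eq_trans (v := [:: (i, b)] ++ [:: (i, ~~ b)])); last first.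
  exact: word_eq_cancel.
apply: word_eq_cat; last exact: word_eq_refl.
by rewrite -[X in word_eq _ X]cats0; apply: word_eq_cat => //; exact: word_eq_refl.
Qed.

Lemma word_eq_mulVl u : word_eq (word_inv u ++ u) [::].
Proof. by rewrite -{2}(word_invK u); exact: word_eq_mulV. Qed.

Lemma word_eq_inv u v : word_eq u v -> word_eq (word_inv u) (word_inv v).
Proof.
move=> uv; apply: (word_eq_trans (v := word_inv u ++ (v ++ word_inv v))).
  rewrite -[X in word_eq X _]cats0.
  by apply: word_eq_cat; [exact: word_eq_refl|exact/word_eq_sym/word_eq_mulV].
rewrite catA -[X in word_eq _ X]cat0s; apply: word_eq_cat; last exact: word_eq_refl.
apply: (word_eq_trans (v := word_inv u ++ u)); last exact: word_eq_mulVl.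
by apply: word_eq_cat; [exact: word_eq_refl|exact: word_eq_sym].
Qed.

Definition pi1_one : pi1 := \pi_pi1 [::].
Definition pi1_mul (g h : pi1) : pi1 := \pi_pi1 (repr g ++ repr h).
Definition pi1_inv (g : pi1) : pi1 := \pi_pi1 (word_inv (repr g)).

Lemma pi1_mulE u v : pi1_mul (\pi_pi1 u) (\pi_pi1 v) = \pi_pi1 (u ++ v).
Proof. by apply/pi1_eqP/word_eq_cat; exact: pi1_reprP. Qed.

Lemma pi1_invE u : pi1_inv (\pi_pi1 u) = \pi_pi1 (word_inv u).
Proof. by apply/pi1_eqP/word_eq_inv/pi1_reprP. Qed.

Lemma pi1_mulA : associative pi1_mul.
Proof.
move=> g h k; rewrite -(reprK g) -(reprK h) -(reprK k).
by rewrite (pi1_mulE (repr h) (repr k)) (pi1_mulE (repr g) (repr h)) !pi1_mulE catA.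
Qed.

Lemma pi1_mul1g : left_id pi1_one pi1_mul.
Proof. by move=> g; rewrite -(reprK g) pi1_mulE. Qed.

Lemma pi1_mulg1 : right_id pi1_one pi1_mul.
Proof. by move=> g; rewrite -(reprK g) pi1_mulE cats0. Qed.

Lemma pi1_mulVg : left_inverse pi1_one pi1_inv pi1_mul.
Proof.
move=> g; rewrite -(reprK g) pi1_invE pi1_mulE.
exact/pi1_eqP/word_eq_mulVl.
Qed.

Lemma pi1_mulgV : right_inverse pi1_one pi1_inv pi1_mul.
Proof.
move=> g; rewrite -(reprK g) pi1_invE pi1_mulE.
exact/pi1_eqP/word_eq_mulV.
Qed.

HB.instance Definition _ := isGroup.Build pi1
  pi1_mulA pi1_mul1g pi1_mulg1 pi1_mulVg pi1_mulgV.

(* c_i, going once counterclockwise around the i-th puncture. *)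
Definition puncture_loop (i : 'I_4) : pi1 := \pi_pi1 [:: (i, false)].

(* The elements represented by loops freely homotopic to a multiple (of either
   orientation) of a circle around one puncture. *)
Definition peripheral (g : pi1) : Prop :=
  exists i n h, g = (h * puncture_loop i ^+ n * h^-1)%g \/
                g = (h * puncture_loop i ^- n * h^-1)%g.

Definition SL2 (R : realType) : Type := [set A : 'M[R]_2 | \det A = 1].
HB.instance Definition _ R := Topological.on (SL2 R).

Section SL2.
Variable R : realType.
Implicit Types A B : SL2 R.

Lemma SL2_det A : \det (val A) = 1.
Proof. exact: (set_mem (valP A)). Qed.

Lemma SL2_unit A : val A \in unitmx.
Proof. by rewrite unitmxE SL2_det unitr1. Qed.

Definition mkSL2 (M : 'M[R]_2) (hM : \det M = 1) : SL2 R :=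
  exist _ M (mem_set hM).

Lemma SL2_det1 : \det (1%:M : 'M[R]_2) = 1. Proof. exact: det1. Qed.

Lemma SL2_detM A B : \det (val A *m val B) = 1.
Proof. by rewrite det_mulmx !SL2_det mulr1. Qed.

Lemma SL2_detV A : \det (invmx (val A)) = 1.
Proof. by rewrite det_inv SL2_det invr1. Qed.

Lemma SL2_detN A : \det (- val A) = 1.
Proof. by rewrite -scaleN1r detZ SL2_det mulr1 sqrrN expr1n. Qed.

Definition SL2_one : SL2 R := mkSL2 SL2_det1.
Definition SL2_mul A B : SL2 R := mkSL2 (SL2_detM A B).
Definition SL2_inv A : SL2 R := mkSL2 (SL2_detV A).
Definition SL2_opp A : SL2 R := mkSL2 (SL2_detN A).

Lemma SL2_mulA : associative SL2_mul.
Proof. by move=> A B C; apply: val_inj; rewrite /= mulmxA. Qed.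

Lemma SL2_mul1 : left_id SL2_one SL2_mul.
Proof. by move=> A; apply: val_inj; rewrite /= mul1mx. Qed.

Lemma SL2_mulr1 : right_id SL2_one SL2_mul.
Proof. by move=> A; apply: val_inj; rewrite /= mulmx1. Qed.

Lemma SL2_mulV : left_inverse SL2_one SL2_inv SL2_mul.
Proof. by move=> A; apply: val_inj; rewrite /= mulVmx // SL2_unit. Qed.

Lemma SL2_mulrV : right_inverse SL2_one SL2_inv SL2_mul.
Proof. by move=> A; apply: val_inj; rewrite /= mulmxV // SL2_unit. Qed.

HB.instance Definition _ := isGroup.Build (SL2 R)
  SL2_mulA SL2_mul1 SL2_mulr1 SL2_mulV SL2_mulrV.

Definition eq_pm A B : bool := (A == B) || (A == SL2_opp B).

Lemma SL2_oppK : involutive SL2_opp.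
Proof. by move=> A; apply: val_inj; rewrite /= opprK. Qed.

Lemma eq_pm_equiv : equiv_class_of eq_pm.
Proof.
split=> [A|A B|B A C]; rewrite /eq_pm ?eqxx //.
- by rewrite (eq_sym B) (eq_sym B) (can2_eq SL2_oppK SL2_oppK).
- move=> /orP[]/eqP-> /orP[]/eqP->; rewrite ?SL2_oppK eqxx ?orbT //.
Qed.

Canonical pm_equiv := EquivRelPack eq_pm_equiv.

End SL2.

Definition PSL2 (R : realType) : Type := quotient_topology {eq_quot pm_equiv R}.
HB.instance Definition _ R := Topological.on (PSL2 R).

Section PSL2.
Variable R : realType.
Implicit Types g h : PSL2 R.

Definition PSL2_one : PSL2 R := \pi_(PSL2 R) 1%g.
Definition PSL2_mul g h : PSL2 R := \pi_(PSL2 R) (repr g * repr h)%g.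
Definition PSL2_inv g : PSL2 R := \pi_(PSL2 R) (repr g)^-1%g.

Lemma PSL2_eqP (A B : SL2 R) :
  \pi_(PSL2 R) A = \pi_(PSL2 R) B <-> A = B \/ A = SL2_opp B.
Proof.
split; first by move/eqquotP/orP => -[]/eqP; [left|right].
by move=> AB; apply/eqquotP/orP; case: AB => ->; [left|right].
Qed.

Lemma PSL2_mulE (A B : SL2 R) : PSL2_mul (\pi_(PSL2 R) A) (\pi_(PSL2 R) B) = \pi_(PSL2 R) (A * B)%g.
Proof.
have /PSL2_eqP hA := reprK (\pi_(PSL2 R) A).
have /PSL2_eqP hB := reprK (\pi_(PSL2 R) B).
apply/PSL2_eqP; case: hA => ->; case: hB => ->; [left|right|right|left] => //;
  by apply: val_inj; rewrite /= ?mulNmx ?mulmxN ?opprK.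
Qed.

Lemma PSL2_invE (A : SL2 R) : PSL2_inv (\pi_(PSL2 R) A) = \pi_(PSL2 R) (A^-1)%g.
Proof.
have /PSL2_eqP hA := reprK (\pi_(PSL2 R) A).
apply/PSL2_eqP; case: hA => ->; [by left|right].
apply: val_inj => /=.
have uA : - val A \in unitmx by exact: (SL2_unit (SL2_opp A)).
apply: (can_inj (mulmxK uA)).
by rewrite mulVmx // mulNmx mulmxN opprK mulVmx // SL2_unit.
Qed.

Lemma PSL2_mulA : associative PSL2_mul.
Proof.
move=> g h k; rewrite -(reprK g) -(reprK h) -(reprK k).
by rewrite (PSL2_mulE (repr h) (repr k)) (PSL2_mulE (repr g) (repr h)) !PSL2_mulE mulgA.
Qed.

Lemma PSL2_mul1g : left_id PSL2_one PSL2_mul.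
Proof. by move=> g; rewrite -(reprK g) PSL2_mulE mul1g. Qed.

Lemma PSL2_mulg1 : right_id PSL2_one PSL2_mul.
Proof. by move=> g; rewrite -(reprK g) PSL2_mulE mulg1. Qed.

Lemma PSL2_mulVg : left_inverse PSL2_one PSL2_inv PSL2_mul.
Proof. by move=> g; rewrite -(reprK g) PSL2_invE PSL2_mulE mulVg. Qed.

Lemma PSL2_mulgV : right_inverse PSL2_one PSL2_inv PSL2_mul.
Proof. by move=> g; rewrite -(reprK g) PSL2_invE PSL2_mulE mulgV. Qed.

HB.instance Definition _ := isGroup.Build (PSL2 R)
  PSL2_mulA PSL2_mul1g PSL2_mulg1 PSL2_mulVg PSL2_mulgV.

(* Neither the square of the trace nor membership below depends on the choice
   of the representative in SL2. *)
Definition parabolic g : Prop := g != 1%g /\ (\tr (val (repr g))) ^+ 2 = 4.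

Definition positive_parabolic g : Prop :=
  exists (h : PSL2 R) (B : SL2 R),
    [/\ (h * g * h^-1)%g = \pi_(PSL2 R) B, val B 1 0 = 0, \tr (val B) = 2
      & 0 < val B 0 1].

(* Zariski-closed subsets of PSL2: those whose preimage in SL2 is the zero
   locus of a family of real polynomials in the four matrix entries. *)
Definition zariski_closed (Z : set (PSL2 R)) : Prop :=
  exists S : set (mpoly.mpoly (2 * 2) R),
    [set A : SL2 R | Z (\pi_(PSL2 R) A)] =
    [set A : SL2 R | forall p, S p -> mpoly.meval (mxvec (val A) 0) p = 0].

Definition zariski_dense (X : set (PSL2 R)) : Prop :=
  forall Z, zariski_closed Z -> X `<=` Z -> Z = setT.

(* The universal cover R -> RP^1 of the boundary of the hyperbolic plane:
   t is sent to the line spanned by (sin t, cos t), that is to w = tan t in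
   R u {oo}.  PSL2 acts on w by Moebius maps, w increases with t, and one
   positive full turn is t |-> t + pi. *)
Definition bdry (t : R) : 'cV[R]_2 := \col_i (if i == 0 then sin t else cos t).

(* The universal cover of PSL2 is the group of lifts to R of the boundary
   actions of the elements of PSL2. *)
Definition is_lift g (f : R -> R) : Prop :=
  continuous f /\
  forall t, exists l, val (repr g) *m bdry t = l *: bdry (f t).

(* The lift of a parabolic element having fixed points exists and is unique. *)
Definition fixed_lift g (f : R -> R) : Prop :=
  is_lift g f /\ exists t, f t = t.

End PSL2.

Section representations.
Variable R : realType.

(* With the discrete topology on pi1 every homomorphism is continuous, and the
   compact-open topology is the usual one on the set of representations. *)
Definition rep_space : Type :=
  {compact-open, discrete_topology pi1 -> PSL2 R}.
HB.instance Definition _ := Topological.on rep_space.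

Implicit Types rho : rep_space.

Definition representation rho : Prop :=
  forall g h : pi1, rho (g * h)%g = (rho g * rho h)%g.

Definition type_preserving rho : Prop :=
  forall g : pi1, peripheral g -> g != 1%g -> parabolic (rho g).

Definition non_elementary rho : Prop := zariski_dense (range rho).

Definition puncture_sign rho (i : 'I_4) : int :=
  if `[< positive_parabolic (rho (puncture_loop i)) >] then 1 else -1.

Definition has_euler_class rho (k : int) : Prop :=
  exists f : 'I_4 -> R -> R,
    (forall i, fixed_lift (rho (puncture_loop i)) (f i)) /\
    forall t, f 0 (f 1 (f 2 (f 3 t))) = t + k%:~R * pi.

Definition type_preserving_reps (k : int) (s : 'I_4 -> int) : set rep_space :=
  [set rho | [/\ representation rho, type_preserving rho, non_elementary rho,
                 has_euler_class rho k & forall i, puncture_sign rho i = s i]].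

Definition conjugate rho1 rho2 : Prop :=
  exists h : PSL2 R, forall g : pi1, rho2 g = (h * rho1 g * h^-1)%g.

Section moduli.
Variables (k : int) (s : 'I_4 -> int).

Definition conjb (rho1 rho2 : type_preserving_reps k s) : bool :=
  `[< conjugate (val rho1) (val rho2) >].

Lemma conjb_equiv : equiv_class_of conjb.
Proof.
have sym (x y : rep_space) : conjugate x y -> conjugate y x.
  move=> [h hE]; exists h^-1%g => g.
  by rewrite hE invgK !mulgA mulVg mul1g mulgVK.
split=> [x|x y|y x z].
- by apply/asboolP; exists 1%g => g; rewrite invg1 mulg1 mul1g.
- by apply/asboolP/asboolP; exact: sym.
- move=> /asboolP[h hE] /asboolP[h' h'E]; apply/asboolP; exists (h' * h)%g => g.
  by rewrite h'E hE invgM !mulgA.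
Qed.

Canonical conj_equiv := EquivRelPack conjb_equiv.

Definition moduli : Type := quotient_topology {eq_quot conj_equiv}.
HB.instance Definition _ := Topological.on moduli.

End moduli.
End representations.

(* Main.v *)
(* A parabolic element lifts uniquely to a matrix of trace 2, which is a
   transvection I + e v w(v, .), where w is the area form, e = 1 or -1 its sign
   and v is determined up to sign.  So a representation is a quadruple of
   transvections with product d I, d = 1 or -1, and it is non-elementary if and
   only if the four vectors are not all parallel: if two of them are not, their
   transvections generate a Zariski-dense subgroup.

   Euler class: the lift of a positive (negative) parabolic element moves points
   of the line by an amount in [0, pi) (in (-pi, 0]).  The total displacement
   e(rho) pi is a sum of four such amounts along an orbit, and the orbit can be
   chosen so that any prescribed one of them vanishes.  This bounds e(rho) in
   terms of the signs, shows that d = (-1)^e(rho), and shows that conversely d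
   and the signs determine e(rho) in all the cases at hand.

   Connectedness: rotating the punctures, the Hurwitz move
   (A, B) |-> (A B A^-1, A) and conjugation by diag(1, -1) reduce the sign
   patterns to ++++, +++- (with d = -1) and +-+- (with d = 1).  With signs
   (1, b, 1), the first three vectors are determined up to conjugation by
   x = w(v1, v2), y = w(v2, v3), z = w(v3, v1), and the fourth transvection
   exists exactly on a cubic surface, quadratic in z.  Changing the signs of v1
   and v3 makes x and y nonnegative; then (x, y) ranges over a convex set, over
   which the surface consists of two sheets that meet (for +-+-, after changing
   the sign of v1). *)
Require Import Defs.
From HB Require Import structures.
From mathcomp Require Import all_boot all_order all_algebra.
From mathcomp Require Import all_classical all_reals all_analysis.
From mathcomp Require Import ring lra.
From mathcomp Require mpoly.
Import Order.TTheory GRing.Theory Num.Theory.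
Import numFieldNormedType.Exports.
Local Open Scope classical_set_scope.
Local Open Scope ring_scope.
Set Implicit Arguments.
Unset Strict Implicit.
Unset Printing Implicit Defensive.
Local Open Scope quotient_scope.

(** * Quadruples of transvections *)

(** Feeds one polynomial hypothesis to [ring]: the second premise is an identity in which [k] is the
    multiplier of that hypothesis. *)
Lemma eqr_lin (R : pzRingType) (k a b p q : R) :
  p = q -> a - b = k * (p - q) -> a = b.
Proof. by move=> -> /eqP; rewrite subrr mulr0 subr_eq0 => /eqP. Qed.

Lemma ord4_ind (P : 'I_4 -> Prop) : P 0 -> P 1 -> P 2 -> P 3 -> forall i, P i.
Proof.
move=> P0 P1 P2 P3 [[|[|[|[|//]]]] hi].
- by rewrite (_ : Ordinal hi = 0) //; exact: val_inj.
- by rewrite (_ : Ordinal hi = 1) //; exact: val_inj.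
- by rewrite (_ : Ordinal hi = 2) //; exact: val_inj.
- by rewrite (_ : Ordinal hi = 3) //; exact: val_inj.
Qed.

Definition q4 (T : Type) (a b c d : T) (i : 'I_4) : T :=
  if i == 0 then a else if i == 1 then b else if i == 2 then c else d.

Lemma q4_eta (T : Type) (q : 'I_4 -> T) : q4 (q 0) (q 1) (q 2) (q 3) = q.
Proof. by apply/funext; elim/ord4_ind. Qed.

(** * Two-by-two matrices by entries *)

Section mx2.
Variable R : comUnitRingType.
Implicit Types M N : 'M[R]_2.

Definition mx2 (a b c d : R) : 'M[R]_2 :=
  \matrix_(i, j) if i == 0 then (if j == 0 then a else b)
                 else (if j == 0 then c else d).

Lemma mx2E a b c d :
  ((mx2 a b c d 0 0 = a) * (mx2 a b c d 0 1 = b) *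
   (mx2 a b c d 1 0 = c) * (mx2 a b c d 1 1 = d))%type.
Proof. by rewrite !mxE. Qed.

Lemma ord2_ind (P : 'I_2 -> Prop) : P 0 -> P 1 -> forall i, P i.
Proof.
move=> P0 P1 [[|[|//]] hi].
- by rewrite (_ : Ordinal hi = 0) //; exact: val_inj.
- by rewrite (_ : Ordinal hi = 1) //; exact: val_inj.
Qed.

Lemma mx2P M N : M 0 0 = N 0 0 -> M 0 1 = N 0 1 -> M 1 0 = N 1 0 ->
  M 1 1 = N 1 1 -> M = N.
Proof. by move=> *; apply/matrixP; elim/ord2_ind; elim/ord2_ind. Qed.

Lemma mulmx2 M N i j : (M *m N) i j = M i 0 * N 0 j + M i 1 * N 1 j.
Proof. by rewrite mxE !big_ord_recl big_ord0 addr0; congr (_ + M i _ * N _ j);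
  exact: val_inj. Qed.

Lemma trmx2 M : \tr M = M 0 0 + M 1 1.
Proof. by rewrite /mxtrace !big_ord_recl big_ord0 addr0; congr (_ + M _ _);
  exact: val_inj. Qed.

Lemma detmx2 M : \det M = M 0 0 * M 1 1 - M 0 1 * M 1 0.
Proof.
rewrite (expand_det_row _ 0) !big_ord_recl big_ord0 addr0 /cofactor !det_mx11 !mxE /=.
rewrite expr0 expr1 mul1r mulN1r mulrN; congr (_ * M _ _ - M _ _ * M _ _);
  exact: val_inj.
Qed.

Lemma scalar_mx2 (a : R) : (((a%:M : 'M[R]_2) 0 0 = a) * ((a%:M : 'M[R]_2) 0 1 = 0) *
   ((a%:M : 'M[R]_2) 1 0 = 0) * ((a%:M : 'M[R]_2) 1 1 = a))%type.
Proof. by rewrite !mxE /= !mulr1n !mulr0n. Qed.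

Lemma invmx2 M : \det M = 1 -> invmx M = mx2 (M 1 1) (- M 0 1) (- M 1 0) (M 0 0).
Proof.
move=> h; have u : M \in unitmx by rewrite unitmxE h unitr1.
apply: (can_inj (mulmxK u)); rewrite mulVmx //; move: h; rewrite detmx2 => h.
apply: mx2P; rewrite mulmx2 !mx2E !scalar_mx2 -?h; ring.
Qed.

End mx2.

Section good.
Variable R : realType.
Local Notation quad := ('I_4 -> SL2 R).
Implicit Types (A B T h : SL2 R) (q : quad) (a c x y : R).

Lemma SL2_eqP A B : val A = val B -> A = B. Proof. exact: val_inj. Qed.

Lemma SL2_valM A B i j : val (A * B)%g i j =
  val A i 0 * val B 0 j + val A i 1 * val B 1 j.
Proof. exact: mulmx2. Qed.

Lemma SL2_valV A : val A^-1%g =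
  mx2 (val A 1 1) (- val A 0 1) (- val A 1 0) (val A 0 0).
Proof. exact/invmx2/SL2_det. Qed.

Lemma SL2_val1 : val (1%g : SL2 R) = 1%:M. Proof. by []. Qed.

Lemma SL2_det2 A : val A 0 0 * val A 1 1 - val A 0 1 * val A 1 0 = 1.
Proof. by rewrite -detmx2 SL2_det. Qed.

Definition sl2 (a b c d : R) (H : a * d - b * c = 1) : SL2 R.
Proof. by apply: (@mkSL2 R (mx2 a b c d)); rewrite detmx2 !mx2E. Defined.

Lemma sl2E a b c d H : val (@sl2 a b c d H) = mx2 a b c d. Proof. by []. Qed.

(* The parabolic matrix I + e v w(v, .), where v = (a, c) and w is the standard
   area form. *)
Definition transvection (e a c : R) : 'M[R]_2 :=
  mx2 (1 - e * a * c) (e * a ^+ 2) (- (e * c ^+ 2)) (1 + e * a * c).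

Lemma transvection_det (e a c : R) : (1 - e * a * c) * (1 + e * a * c) -
  (e * a ^+ 2) * (- (e * c ^+ 2)) = 1.
Proof. ring. Qed.

(** [e] may be any real number, so powers and inverses of a transvection stay in the family, with
    the same vector. *)
Definition transv (e a c : R) : SL2 R := sl2 (transvection_det e a c).

Definition parab (e : R) T : Prop :=
  exists a c, (a != 0) || (c != 0) /\ T = transv e a c.

(** An element of SL2 preserves the area form, so conjugating by [h] only replaces the vector v by h
    v. *)
Lemma transvJ (e a c : R) h : (h * transv e a c * h^-1)%g =
  transv e (val h 0 0 * a + val h 0 1 * c) (val h 1 0 * a + val h 1 1 * c).
Proof.
apply: SL2_eqP; have hh := SL2_det2 h.
apply: mx2P; rewrite !SL2_valM SL2_valV !sl2E !mx2E; try ring.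
- by apply: (eqr_lin (k := 1) hh); ring.
- by apply: (eqr_lin (k := 1) hh); ring.
Qed.

Lemma SL2_neq0 h (a c : R) : (a != 0) || (c != 0) ->
  (val h 0 0 * a + val h 0 1 * c != 0) || (val h 1 0 * a + val h 1 1 * c != 0).
Proof.
have hh := SL2_det2 h; apply: contraLR;
  rewrite !negb_or !negbK => /andP[/eqP h1 /eqP h2].
apply/andP; split; apply/eqP.
- transitivity (a * (val h 0 0 * val h 1 1 - val h 0 1 * val h 1 0));
  first by rewrite hh mulr1.
  transitivity (val h 1 1 * (val h 0 0 * a + val h 0 1 * c) -
     val h 0 1 * (val h 1 0 * a + val h 1 1 * c)); [ring|rewrite h1 h2; ring].
- transitivity (c * (val h 0 0 * val h 1 1 - val h 0 1 * val h 1 0));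
  first by rewrite hh mulr1.
  transitivity (val h 0 0 * (val h 1 0 * a + val h 1 1 * c) -
     val h 1 0 * (val h 0 0 * a + val h 0 1 * c)); [ring|rewrite h1 h2; ring].
Qed.

Lemma parabJ e T h : parab e T -> parab e (h * T * h^-1)%g.
Proof.
move=> [a [c [ac ->]]]; rewrite transvJ.
by do 2!eexists; split; last reflexivity; exact: SL2_neq0.
Qed.

Definition fixes T (a c : R) : Prop :=
  val T 0 0 * a + val T 0 1 * c = a /\ val T 1 0 * a + val T 1 1 * c = c.

Lemma fixesM A B a c : fixes A a c -> fixes B a c -> fixes (A * B)%g a c.
Proof.
move=> [a1 a2] [b1 b2]; split; rewrite !SL2_valM.
- transitivity (val A 0 0 * (val B 0 0 * a + val B 0 1 * c) +
    val A 0 1 * (val B 1 0 * a + val B 1 1 * c)); first by ring.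
  by rewrite b1 b2.
- transitivity (val A 1 0 * (val B 0 0 * a + val B 0 1 * c) +
    val A 1 1 * (val B 1 0 * a + val B 1 1 * c)); first by ring.
  by rewrite b1 b2.
Qed.

Lemma fixesV A a c : fixes A a c -> fixes A^-1%g a c.
Proof.
have hh := SL2_det2 A; move=> [a1 a2]; split; rewrite SL2_valV !mx2E.
- transitivity (val A 1 1 * (val A 0 0 * a + val A 0 1 * c)
    - val A 0 1 * (val A 1 0 * a + val A 1 1 * c)); first by rewrite a1 a2; ring.
  by apply: (eqr_lin (k := a) hh); ring.
- transitivity (val A 0 0 * (val A 1 0 * a + val A 1 1 * c)
    - val A 1 0 * (val A 0 0 * a + val A 0 1 * c)); first by rewrite a1 a2; ring.
  by apply: (eqr_lin (k := c) hh); ring.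
Qed.

Lemma fixesJ h A a c : fixes A a c -> fixes (h * A * h^-1)%g
  (val h 0 0 * a + val h 0 1 * c) (val h 1 0 * a + val h 1 1 * c).
Proof.
have hh := SL2_det2 h; move=> [a1 a2].
set a' := val h 0 0 * a + _; set c' := val h 1 0 * a + _.
have V1 : val h 1 1 * a' - val h 0 1 * c' = a.
  by transitivity (a * (val h 0 0 * val h 1 1 - val h 0 1 * val h 1 0));
   [rewrite /a' /c'; ring|rewrite hh mulr1].
have V2 : val h 0 0 * c' - val h 1 0 * a' = c.
  by transitivity (c * (val h 0 0 * val h 1 1 - val h 0 1 * val h 1 0));
   [rewrite /a' /c'; ring|rewrite hh mulr1].
split; rewrite !SL2_valM SL2_valV !mx2E.
- transitivity (val h 0 0 * (val A 0 0 * (val h 1 1 * a' - val h 0 1 * c') + val A 0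
  1 * (val h 0 0 * c' - val h 1 0 * a'))
   + val h 0 1 * (val A 1 0 * (val h 1 1 * a' - val h 0 1 * c') + val A 1 1 * (val h
     0 0 * c' - val h 1 0 * a')));
   first by ring.
  by rewrite V1 V2 a1 a2.
- transitivity (val h 1 0 * (val A 0 0 * (val h 1 1 * a' - val h 0 1 * c') + val A 0
  1 * (val h 0 0 * c' - val h 1 0 * a'))
   + val h 1 1 * (val A 1 0 * (val h 1 1 * a' - val h 0 1 * c') + val A 1 1 * (val h
     0 0 * c' - val h 1 0 * a')));
   first by ring.
  by rewrite V1 V2 a1 a2.
Qed.

(** The transvection sends u to u + e w(v, u) v, where u = (x, y) and w(v, u) = a y - c x. *)
Lemma fixes_transv (e : R) a c x y : e != 0 ->
  fixes (transv e a c) x y <-> a * y - c * x = 0 \/ (a = 0 /\ c = 0).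
Proof.
move=> e0; rewrite /fixes !sl2E !mx2E; split.
  move=> [h1 h2].
  have k1 : e * a * (a * y - c * x) = 0 by apply: (eqr_lin (k := 1) h1); ring.
  have k2 : e * c * (a * y - c * x) = 0 by apply: (eqr_lin (k := 1) h2); ring.
  have [->|n0] := eqVneq (a * y - c * x) 0; first by left.
  right; move/eqP: k1; rewrite !mulf_eq0 (negbTE e0) (negbTE n0) orbF /= => /eqP ->.
  by move/eqP: k2; rewrite !mulf_eq0 (negbTE e0) (negbTE n0) orbF /= => /eqP ->.
case=> [h|[-> ->]]; last by split; ring.
split.
- by transitivity (x + e * a * (a * y - c * x)); [ring|rewrite h mulr0 addr0].
- by transitivity (y + e * c * (a * y - c * x)); [ring|rewrite h mulr0 addr0].
Qed.

(** A parabolic matrix of trace 2 has 1 as its only eigenvalue, so a common boundary fixed point is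
    a common fixed vector; its absence stands for non-elementarity. *)
Definition common_fixed q : Prop :=
  exists a c, (a != 0) || (c != 0) /\ forall i, fixes (q i) a c.

Definition good (d : R) (e : 'I_4 -> int) q : Prop :=
  [/\ forall i, parab (e i)%:~R (q i),
      val (q 0%R * q 1%R * q 2%R * q 3%R)%g = d%:M & ~ common_fixed q].

Definition conjq h q : quad := fun i => (h * q i * h^-1)%g.

Lemma conjqK h q : conjq h^-1%g (conjq h q) = q.
Proof. by apply/funext => i; rewrite /conjq invgK !mulgA mulVg mul1g mulgVK. Qed.

Lemma SL2_scalar_comm (d : R) A B : val A = d%:M -> (A * B = B * A)%g.
Proof.
move=> h; apply: SL2_eqP; apply: mx2P; rewrite !SL2_valM h !scalar_mx2; ring.
Qed.

Lemma good_conj d e h q : good d e q -> good d e (conjq h q).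
Proof.
move=> [p m f]; split.
- by move=> i; exact: parabJ.
- rewrite (_ : (conjq h q 0%R * conjq h q 1%R * conjq h q 2%R * conjq h q 3%R)%g =
    (h * (q 0%R * q 1%R * q 2%R * q 3%R) * h^-1)%g);
      last by rewrite /conjq !mulgA !mulgVK.
  by rewrite -(SL2_scalar_comm h m) mulgK.
- move=> [a [c [ac H]]]; apply: f.
  exists (val h^-1%g 0 0 * a + val h^-1%g 0 1 * c), (val h^-1%g 1 0 * a + val h^-1%g
    1 1 * c).
  split; first exact: SL2_neq0.
  by move=> i; rewrite -(conjqK h q); exact: fixesJ.
Qed.

(** Conjugate quadruples give the same point of the moduli space, so conjugation generates the
    relation along with paths. *)
Inductive linked (G : quad -> Prop) : quad -> quad -> Prop :=
| linked_path (g : R -> quad) s t :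
    (forall i, continuous (g ^~ i)) -> (forall t, G (g t)) -> linked G (g s) (g t)
| linked_conj h q : G q -> linked G q (conjq h q)
| linked_sym q q' : linked G q q' -> linked G q' q
| linked_trans q q' q'' : linked G q q' -> linked G q' q'' -> linked G q q''.

Definition conn d e : Prop :=
  (exists q, good d e q) /\
  forall q q', good d e q -> good d e q' -> linked (good d e) q q'.

Lemma linked_transport (G G' : quad -> Prop) (phi : quad -> quad) q q' :
  (forall q, G q -> G' (phi q)) ->
  (forall g : R -> quad, (forall i, continuous (g ^~ i)) ->
     forall i, continuous (fun t => phi (g t) i)) ->
  (forall h q, exists h', phi (conjq h q) = conjq h' (phi q)) ->
  linked G q q' -> linked G' (phi q) (phi q').
Proof.
move=> GG' cphi jphi; elim.
- by move=> g s t gc gG; apply: (@linked_path _ (phi \o g)); [exact: cphi|move=> ?;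
  exact: GG'].
- by move=> h p Gp; have [h' ->] := jphi h p; apply: linked_conj; exact: GG'.
- by move=> p p' _ ?; exact: linked_sym.
- by move=> p p' p'' _ h1 _ h2; exact: linked_trans h1 h2.
Qed.

(** Every target quadruple is [phi (psi p)], so a link between [psi p] and [psi p'] is pushed
    forward by [phi]. *)
Lemma conn_transport d e d' e' (phi psi : quad -> quad) :
  (forall q, good d e q -> good d' e' (phi q)) ->
  (forall q, good d' e' q -> good d e (psi q)) ->
  (forall q, phi (psi q) = q) ->
  (forall g : R -> quad, (forall i, continuous (g ^~ i)) ->
     forall i, continuous (fun t => phi (g t) i)) ->
  (forall h q, exists h', phi (conjq h q) = conjq h' (phi q)) ->
  conn d e -> conn d' e'.
Proof.
move=> hphi hpsi K cphi jphi [[q Gq] H]; split; first by exists (phi q); exact: hphi.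
move=> p p' Gp Gp'; rewrite -(K p) -(K p');
  apply: linked_transport (H _ _ (hpsi _ Gp) (hpsi _ Gp')) => //.
Qed.

(** Rotating the factors conjugates their product by [q 0], which changes nothing because the
    product is scalar. *)
Lemma good_rot d e q : good d e q -> good d (fun i => e (i + 1)) (fun i => q (i + 1)).
Proof.
move=> [p m f]; split; first by move=> i; exact: p.
- change (val (q (0 + 1)%R * q (1 + 1)%R * q (2 + 1)%R * q (3 + 1)%R)%g = d%:M).
  have -> : 0 + 1 = 1 :> 'I_4 by exact: val_inj.
  have -> : 1 + 1 = 2 :> 'I_4 by exact: val_inj.
  have -> : 2 + 1 = 3 :> 'I_4 by exact: val_inj.
  have -> : 3 + 1 = 0 :> 'I_4 by exact: val_inj.
  have -> : (q 1%R * q 2%R * q 3%R * q 0%R = (q 0%R)^-1 * ((q 0%R * q 1%R * q 2%R * q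
    3%R) * q 0%R))%g.
    by rewrite !mulgA mulVg mul1g.
  by rewrite (SL2_scalar_comm _ m) mulgA mulVg mul1g.
- move=> [a [c [ac H]]]; apply: f; exists a, c; split=> // i.
  by rewrite -(subrK 1 i); exact: H.
Qed.

Lemma conn_rot d e : conn d e -> conn d (fun i => e (i + 1)).
Proof.
apply: (@conn_transport _ _ _ _ (fun q i => q (i + 1)) (fun q i => q (i - 1))).
- exact: good_rot.
(* Rotating back once is rotating forward three times. *)
- move=> q /good_rot/good_rot/good_rot; congr good; apply/funext => i; congr (_ _);
  apply: val_inj;
  by move: i; elim/ord4_ind.
- by move=> q; apply/funext => i; rewrite addrK.
- by move=> g gc i; exact: gc.
- by move=> h q; exists h.
Qed.

Lemma SL2_continuousP (T : topologicalType) (f : T -> SL2 R) :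
  (forall i j, continuous (fun t => val (f t) i j)) <-> continuous f.
Proof.
split=> [H|H i j t].
  apply: continuous_comp_initial => t.
  move=> /= B [A hA] sub.
  rewrite nbhs_filterE /=.
  have : \forall s \near t, forall i j, A i j (val (f s) i j).
    by apply: filter_forall => i; apply: filter_forall => j; exact/H/hA.
  by apply: filterS => s hs; apply: sub.
have c1 : {for t, continuous (val \o f)}.
  by apply: continuous_comp; [exact: H|exact: initial_continuous].
exact: (@continuous_comp _ _ _ (val \o f) (fun M =>
  M i j) t c1 (@coord_continuous _ _ _ i j _)).
Qed.
End good.

(** * Moves between sign patterns *)

Section moves.
Variable R : realType.
Local Notation quad := ('I_4 -> SL2 R).
Implicit Types (A B T h : SL2 R) (q : quad) (a c x y : R).

Lemma SL2_mul_continuous (T : topologicalType) (f g : T -> SL2 R) :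
  continuous f -> continuous g -> continuous (fun t => (f t * g t)%g).
Proof.
move=> /SL2_continuousP cf /SL2_continuousP cg; apply/SL2_continuousP => i j t.
under eq_fun do rewrite SL2_valM.
by apply: cvgD; apply: cvgM; (exact: cf || exact: cg).
Qed.

Lemma SL2_continuous_entries (T : topologicalType) (f : T -> SL2 R) (a b c d : T -> R) :
  (forall t, val (f t) = mx2 (a t) (b t) (c t) (d t)) ->
  continuous a -> continuous b -> continuous c -> continuous d -> continuous f.
Proof.
move=> fE ca cb cc cd; apply/SL2_continuousP; elim/ord2_ind; elim/ord2_ind.
- by rewrite (_ : (fun t => _) = a) //; apply/funext => t; rewrite fE mx2E.
- by rewrite (_ : (fun t => _) = b) //; apply/funext => t; rewrite fE mx2E.
- by rewrite (_ : (fun t => _) = c) //; apply/funext => t; rewrite fE mx2E.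
- by rewrite (_ : (fun t => _) = d) //; apply/funext => t; rewrite fE mx2E.
Qed.

Lemma SL2_inv_continuous (T : topologicalType) (f : T -> SL2 R) :
  continuous f -> continuous (fun t => (f t)^-1%g).
Proof.
move=> /SL2_continuousP cf.
by apply: (SL2_continuous_entries (fun t => SL2_valV (f t))) => t;
  (exact: cf || (apply: cvgN; exact: cf)).
Qed.

Definition swapq q : quad :=
  q4 (q 0%R * q 1%R * (q 0%R)^-1)%g (q 0) (q 2) (q 3).
Definition unswapq q : quad :=
  q4 (q 1) ((q 1%R)^-1 * q 0%R * q 1%R)%g (q 2) (q 3).

Lemma unswapqK q : swapq (unswapq q) = q.
Proof.
rewrite -[RHS]q4_eta /swapq /unswapq /q4 /= !mulgA mulgV mul1g.
by rewrite -!mulgA mulgV mulg1.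
Qed.

(** The Hurwitz move keeps the product and the subgroup generated by the entries, hence also their
    common fixed vectors. *)
Lemma good_swap d e q : good d e q -> good d (q4 (e 1) (e 0) (e 2) (e 3)) (swapq q).
Proof.
move=> [p m f]; split.
- by elim/ord4_ind; rewrite /q4 /=; [exact/parabJ/p|exact: p..].
- rewrite -m; congr (val _).
  rewrite (_ : swapq q 0 = q 0%R * q 1%R * (q 0%R)^-1)%g //.
  by rewrite (_ : swapq q 1 = q 0) // mulgVK.
- move=> [a [c [ac H]]]; apply: f; exists a, c; split=> //.
  have H0 := H 1; have H1 := H 0; have H2 := H 2; have H3 := H 3.
  rewrite /swapq /q4 /= in H0 H1 H2 H3.
  elim/ord4_ind => //.
  rewrite (_ : q 1%R = (q 0%R)^-1 * (q 0%R * q 1%R * (q 0%R)^-1) * q 0%R)%g; last first.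
    by rewrite !mulgA mulVg mul1g mulgVK.
  by apply: fixesM => //; apply: fixesM => //; exact: fixesV.
Qed.

Lemma good_unswap d e q : good d (q4 (e 1) (e 0) (e 2) (e 3)) q -> good d e (unswapq q).
Proof.
move=> [p m f]; split.
- elim/ord4_ind; [exact: (p 1)| |exact: (p 2)|exact: (p 3)].
  by have := parabJ (q 1%R)^-1%g (p 0); rewrite invgK.
- rewrite -m; congr (val _).
  rewrite (_ : unswapq q 0 = q 1) // (_ : unswapq q 1%R = (q 1%R)^-1 * q 0%R * q
    1%R)%g //.
  by rewrite !mulgA mulgV mul1g.
- move=> [a [c [ac H]]]; apply: f; exists a, c; split=> //.
  have H0 := H 1; have H1 := H 0; have H2 := H 2; have H3 := H 3.
  rewrite /unswapq /q4 /= in H0 H1 H2 H3.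
  elim/ord4_ind => //.
  rewrite (_ : q 0 = q 1%R * ((q 1%R)^-1 * q 0%R * q 1%R) * (q 1%R)^-1)%g; last first.
    by rewrite !mulgA mulgV mul1g -mulgA mulgV mulg1.
  by apply: fixesM; [apply: fixesM|exact: fixesV].
Qed.

Lemma conn_swap (d : R) e : conn d e -> conn d (q4 (e 1) (e 0) (e 2) (e 3)).
Proof.
apply: (@conn_transport R _ _ _ _ swapq unswapq).
- exact: good_swap.
- exact: good_unswap.
- exact: unswapqK.
- move=> g gc; elim/ord4_ind; rewrite /swapq /q4 /=; [|exact: gc..].
  by apply: SL2_mul_continuous; [exact: SL2_mul_continuous|exact: SL2_inv_continuous].
- move=> h q; exists h; rewrite /swapq /conjq; apply/funext; elim/ord4_ind;
  rewrite /q4 //=.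
  by rewrite !invgM invgK !mulgA !mulgVK.
Qed.

Lemma mirror_det A : val A 0 0 * val A 1 1 - (- val A 0 1) * (- val A 1 0) = 1.
Proof. by rewrite mulrNN SL2_det2. Qed.

(* Conjugation by diag(1, -1), which reverses the orientation of the hyperbolic
   plane. *)
Definition mirror A : SL2 R := sl2 (mirror_det A).

Lemma mirrorM A B : mirror (A * B)%g = (mirror A * mirror B)%g.
Proof. by apply: SL2_eqP; apply: mx2P; rewrite !SL2_valM !sl2E !mx2E !SL2_valM;
  ring. Qed.

Lemma mirrorV A : mirror A^-1%g = (mirror A)^-1%g.
Proof. by apply: SL2_eqP; apply: mx2P; rewrite !SL2_valV !sl2E SL2_valV !mx2E. Qed.

Lemma mirrorK A : mirror (mirror A) = A.
Proof. by apply: SL2_eqP; apply: mx2P; rewrite !sl2E !mx2E ?opprK. Qed.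

(** The reflection negates w, so it flips the sign of a transvection. *)
Lemma mirror_transv (e a c : R) : mirror (transv e a c) = transv (- e) a (- c).
Proof. by apply: SL2_eqP; apply: mx2P; rewrite !sl2E !mx2E; ring. Qed.

Lemma fixes_mirror A a c : fixes A a c -> fixes (mirror A) a (- c).
Proof.
move=> [h1 h2]; split; rewrite !sl2E !mx2E; first by rewrite mulrNN.
by rewrite mulrN mulNr -opprD h2.
Qed.

Lemma good_mirror d e q : good d e q -> good d (fun i => - e i) (fun i => mirror (q i)).
Proof.
move=> [p m f]; split.
- move=> i; have [a [c [ac /= ->]]] := p i; exists a, (- c);
  rewrite oppr_eq0 mirror_transv; split=> //.
  by rewrite mulrNz.
- rewrite -!mirrorM.
  by apply: mx2P; rewrite sl2E !mx2E m !scalar_mx2 ?oppr0.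
- move=> [a [c [ac H]]]; apply: f; exists a, (- c); rewrite oppr_eq0; split=> // i.
  by rewrite -(mirrorK (q i)); apply: fixes_mirror; exact: H.
Qed.

Lemma conn_mirror (d : R) e : conn d e -> conn d (fun i => - e i).
Proof.
apply: (@conn_transport R _ _ _ _ (fun q i => mirror (q i)) (fun q i => mirror (q i))).
- exact: good_mirror.
- by move=> q /good_mirror; congr good; apply/funext => i; rewrite opprK.
- by move=> q; apply/funext => i; rewrite mirrorK.
- move=> g gc i; have /SL2_continuousP ci := gc i.
  by apply: (SL2_continuous_entries (fun t => sl2E (mirror_det (g t i)))) => t;
    (exact: ci || (apply: cvgN; exact: ci)).
- by move=> h q; exists (mirror h); apply/funext => i; rewrite /conjq !mirrorM mirrorV.
Qed.
End moves.

(** * Normal form *)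

Section normal_form.
Variable R : realType.
Local Notation quad := ('I_4 -> SL2 R).
Implicit Types (A B T h : SL2 R) (q : quad) (a c x y z : R).

(* w(A v, v) for v = (x, y); on I + e u w(u, .) this is e w(u, v)^2. *)
Definition form A x y : R :=
  (val A 0 0 * x + val A 0 1 * y) * y - (val A 1 0 * x + val A 1 1 * y) * x.

Lemma form_transv (e a c x y : R) : form (transv e a c) x y = e * (a * y - c * x) ^+ 2.
Proof. by rewrite /form !sl2E !mx2E; ring. Qed.

Lemma form_fixes A x y : fixes A x y -> form A x y = 0.
Proof. by rewrite /form => -[-> ->]; ring. Qed.

Lemma tr_transv (e a c : R) : \tr (val (transv e a c)) = 2.
Proof. by rewrite trmx2 !sl2E !mx2E; ring. Qed.

Lemma transvN (e a c : R) : transv e (- a) (- c) = transv e a c.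
Proof. by apply: SL2_eqP; apply: mx2P; rewrite !sl2E !mx2E; ring. Qed.

Lemma ge0_of_sum_prod (u v : R) : 0 <= u * v -> 0 < u + v -> 0 <= u /\ 0 <= v.
Proof. by move=> p s; split; rewrite leNgt; apply/negP => h; nra. Qed.

(** Write A = I + ((1 - k, n), (m, k - 1)). Then e n and - e m have product (1 - k)^2 and positive
    sum, so both are nonnegative, and their square roots are the coordinates of the vector up to
    sign. *)
Lemma parab_off (e : int) A : e = 1 \/ e = -1 -> \tr (val A) = 2 ->
  0 < e%:~R * (val A 0 1 - val A 1 0) -> parab e%:~R A.
Proof.
move=> he; rewrite trmx2 => ht hp.
set er : R := e%:~R in hp *.
have er2 : er * er = 1 by rewrite /er; case: he => ->; ring.
set n := val A 0 1 in hp *; set m := val A 1 0 in hp *; set k := val A 1 1 in ht *.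
have hd := SL2_det2 A; rewrite -/n -/m -/k in hd.
have h0 : val A 0 0 = 2 - k by rewrite -ht; ring.
rewrite h0 in hd.
have pr : (er * n) * - (er * m) = (1 - k) ^+ 2.
  apply: (eqr_lin (k := - n * m) er2); apply: (eqr_lin (k := 1) hd); ring.
have [n0 m0] : 0 <= er * n /\ 0 <= - (er * m).
  rewrite mulrBr in hp; apply: ge0_of_sum_prod; first by rewrite pr sqr_ge0.
  exact: hp.
pose a := Num.sqrt (er * n); pose c := Num.sqrt (- (er * m)).
have a2 : a ^+ 2 = er * n by rewrite sqr_sqrtr.
have c2 : c ^+ 2 = - (er * m) by rewrite sqr_sqrtr.
have ac0 : (a != 0) || (c != 0).
  apply: contraLR hp; rewrite negb_or !negbK => /andP[/eqP a0 /eqP c0].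
  by rewrite mulrBr -a2 -[- _]opprK -opprB opprK;
    rewrite a0 -(opprK (er * m)) -c2 c0; rewrite !expr0n /=; lra.
have ac : (er * a * c) ^+ 2 = (k - 1) ^+ 2.
  rewrite !exprMn a2 c2 expr2 er2 mul1r pr; ring.
(* The sign of the second coordinate is chosen so that the diagonal comes out right. *)
have : exists c', c' ^+ 2 = - (er * m) /\ er * a * c' = k - 1 /\ ((a != 0) || (c' !=
  0)).
  move/eqP: ac; rewrite eqf_sqr => /orP[/eqP h|/eqP h]; first by exists c.
  by exists (- c); rewrite sqrrN oppr_eq0 mulrN h opprK.
move=> [c' [c'2 [ac' nz]]]; exists a, c'; split=> //.
apply: SL2_eqP; apply: mx2P; rewrite sl2E !mx2E ?ac'.
- by rewrite h0; ring.
- by rewrite a2 mulrA er2 mul1r.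
- by rewrite c'2 mulrN opprK mulrA er2 mul1r.
- by rewrite -/k; ring.
Qed.

(** Multiplied by the positive number e f, where f is the value of [form], both e n and - e m become
    squares, so they are nonnegative. If both vanished, A would be I and f would be 0; so
    [parab_off] applies. *)
Lemma parab_form (e : int) A x y : e = 1 \/ e = -1 -> \tr (val A) = 2 ->
  0 < e%:~R * form A x y -> parab e%:~R A.
Proof.
move=> he ht hp; apply: parab_off => //; move: ht hp; rewrite trmx2 /form.
set er : R := e%:~R.
have er2 : er * er = 1 by rewrite /er; case: he => ->; ring.
have hd := SL2_det2 A.
set n := val A 0 1 in hd *; set m := val A 1 0 in hd *;
  set k := val A 1 1 in hd * => ht.
have h0 : val A 0 0 = 2 - k by rewrite -ht; ring.
rewrite !h0 in hd *; set f := (X in er * X) => hf.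
have p1 : (er * n) * (er * f) = (n * y + (1 - k) * x) ^+ 2.
  apply: (eqr_lin (k := n * f) er2); apply: (eqr_lin (k := x ^+ 2) hd); rewrite /f;
    ring.
have p2 : (er * - m) * (er * f) = (m * x + (k - 1) * y) ^+ 2.
  apply: (eqr_lin (k := - m * f) er2); apply: (eqr_lin (k := y ^+ 2) hd); rewrite /f;
    ring.
have n0 : 0 <= er * n.
  by rewrite -(pmulr_lge0 _ hf) p1 sqr_ge0.
have m0 : 0 <= er * - m.
  by rewrite -(pmulr_lge0 _ hf) p2 sqr_ge0.
rewrite mulrBr lt_neqAle; apply/andP; split; last by lra.
apply/eqP => h; have hn : er * n = 0 by lra.
have hm : er * - m = 0 by lra.
have n00 : n = 0 by rewrite -(mul1r n) -er2 -mulrA hn mulr0.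
have m00 : m = 0 by rewrite -(opprK m) -(mul1r (- m)) -er2 -mulrA hm mulr0 oppr0.
move: hf; rewrite /f n00 m00.
rewrite n00 m00 in hd.
have : (k - 1) ^+ 2 = 0 by apply: (eqr_lin (k := -1) hd); ring.
move/eqP; rewrite sqrf_eq0 subr_eq0 => /eqP ->.
by rewrite (_ : er * _ = 0) ?ltxx //; ring.
Qed.

Lemma formV A x y : form A^-1%g x y = - form A x y.
Proof. by rewrite /form SL2_valV !mx2E; ring. Qed.

Lemma form_scalar A B (d : R) x y : val B = d%:M -> form (A * B)%g x y = d * form A x y.
Proof. by move=> h; rewrite /form !SL2_valM h !scalar_mx2; ring. Qed.

(** The vectors are v1 = (p, -x), v2 = (1, 0), v3 = (r, y), so that x = w(v1, v2), y = w(v2, v3) and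
    - (x r + y p) = w(v3, v1). *)
Definition tri (b p x r y : R) : SL2 R :=
  (transv 1 p (- x) * transv b 1 0 * transv 1 r y)%g.

Lemma tri_tr b p x r y (z := - (x * r + y * p)) :
  \tr (val (tri b p x r y)) = 2 - b * x ^+ 2 - b * y ^+ 2 - z ^+ 2 + b * x * y * z.
Proof. by rewrite trmx2 !SL2_valM !sl2E !mx2E /z; ring. Qed.

(** The values at v3 and, in the next lemma, at v1 depend on x, y, z only; they will give the sign
    of the fourth factor. *)
Lemma tri_form3 b p x r y (z := - (x * r + y * p)) :
  form (tri b p x r y) r y = z ^+ 2 + b * y ^+ 2 - b * x * y * z.
Proof. by rewrite /form !SL2_valM !sl2E !mx2E /z; ring. Qed.

Lemma tri_form1 b p x r y (z := - (x * r + y * p)) :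
  form (tri b p x r y) p (- x) = z ^+ 2 + b * x ^+ 2 - b * x * y * z.
Proof. by rewrite /form !SL2_valM !sl2E !mx2E /z; ring. Qed.

Lemma fixes_parab e T x y : e != 0 -> parab e T -> form T x y = 0 -> fixes T x y.
Proof.
move=> e0 [a [c [_ ->]]]; rewrite form_transv => /eqP;
  rewrite mulf_eq0 (negbTE e0) /= sqrf_eq0 => /eqP h.
by apply/fixes_transv => //; left.
Qed.
End normal_form.

Lemma not_parab0 (R : realType) (e : R) : e != 0 -> ~ parab e (transv e 0 0).
Proof.
move=> e0 [a [c [nz E]]]; have E1 := congr1 (fun A : SL2 R => val A 0 1) E.
have E2 := congr1 (fun A : SL2 R => val A 1 0) E.
rewrite !sl2E !mx2E expr0n /= mulr0 in E1 E2.
move/esym/eqP: E1; rewrite mulf_eq0 (negbTE e0) sqrf_eq0 /= => a0.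
move/eqP: E2; rewrite oppr0 eq_sym oppr_eq0 mulf_eq0 (negbTE e0) sqrf_eq0 /= => c0.
by rewrite a0 c0 in nz.
Qed.

(** * Normal form for signs (1, b, 1, e) and product -b I *)

Section standard.
Variables (R : realType) (b e : int) (D : SL2 R).
Hypothesis hb : b = 1 \/ b = -1.
Hypothesis he : e = 1 \/ e = -1.
Hypothesis hD : val D = (- b%:~R)%:M.
Local Notation quad := ('I_4 -> SL2 R).
Implicit Types (q : quad) (x y z : R).
Local Notation br := (b%:~R : R).
Local Notation er := (e%:~R : R).

Let br2 : br * br = 1. Proof. by case: hb => ->; ring. Qed.
Let br0 : br != 0. Proof. by case: hb => ->; rewrite ?oppr_eq0 oner_eq0. Qed.
Let er0 : er != 0. Proof. by case: he => ->; rewrite ?oppr_eq0 oner_eq0. Qed.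
Let er2 : er * er = 1. Proof. by case: he => ->; ring. Qed.

Definition signs : 'I_4 -> int := q4 1 b 1 e.

Definition tri_std x y z : SL2 R :=
  tri br (- (z * y) / (x ^+ 2 + y ^+ 2)) x (- (z * x) / (x ^+ 2 + y ^+ 2)) y.

(* The transvection vectors are v2 = (1, 0), v1 = (-zy/s, -x), v3 = (-zx/s, y)
   with s = x^2 + y^2, so that x = w(v1, v2), y = w(v2, v3), z = w(v3, v1). *)
Definition std x y z : quad :=
  q4 (transv 1 (- (z * y) / (x ^+ 2 + y ^+ 2)) (- x)) (transv br 1 0)
     (transv 1 (- (z * x) / (x ^+ 2 + y ^+ 2)) y) ((tri_std x y z)^-1 * D)%g.

(** This says that the fourth factor has trace 2, which by [last_tr] means that [tri] has trace
    -2b. *)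
Definition surface x y z : Prop :=
  z ^+ 2 - br * x * y * z + br * x ^+ 2 + br * y ^+ 2 = 2 + 2 * br.

(** [adm_v1] and [adm_v3] say that v1 and v3 are nonzero, and [adm_xy] that they are not both
    parallel to v2. The last three fields say that the fourth factor has sign e, tested by [form] at
    v3 and at v1. *)
Record admissible x y z : Prop := Admissible {
  adm_surface : surface x y z;
  adm_xy : 0 < x ^+ 2 + y ^+ 2;
  adm_v1 : (x != 0) || (z != 0);
  adm_v3 : (y != 0) || (z != 0);
  adm_sx : 0 <= er * (2 + 2 * br - x ^+ 2);
  adm_sy : 0 <= er * (2 + 2 * br - y ^+ 2);
  adm_s : er * (2 + 2 * br - x ^+ 2) + er * (2 + 2 * br - y ^+ 2) != 0 }.

Lemma last_form p x r y w1 w2 :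
  form ((tri br p x r y)^-1 * D)%g w1 w2 = br * form (tri br p x r y) w1 w2.
Proof. by rewrite (form_scalar _ _ _ hD) formV mulrNN. Qed.

Lemma last_tr A : \tr (val (A^-1 * D)%g) = - br * \tr (val A).
Proof. by rewrite !trmx2 !SL2_valM SL2_valV hD !scalar_mx2 !mx2E; ring. Qed.

Lemma last_form3 p x r y : surface x y (- (x * r + y * p)) ->
  form ((tri br p x r y)^-1 * D)%g r y = 2 + 2 * br - x ^+ 2.
Proof.
rewrite /surface => S; rewrite last_form tri_form3; set z := - (_ + _) in S *.
apply: (eqr_lin (k := br) S); apply: (eqr_lin (k := 2 - x ^+ 2) br2); ring.
Qed.

Lemma last_form1 p x r y : surface x y (- (x * r + y * p)) ->
  form ((tri br p x r y)^-1 * D)%g p (- x) = 2 + 2 * br - y ^+ 2.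
Proof.
rewrite /surface => S; rewrite last_form tri_form1; set z := - (_ + _) in S *.
apply: (eqr_lin (k := br) S); apply: (eqr_lin (k := 2 - y ^+ 2) br2); ring.
Qed.

Lemma std_z x y z : 0 < x ^+ 2 + y ^+ 2 ->
  - (x * (- (z * x) / (x ^+ 2 + y ^+ 2)) + y * (- (z * y) / (x ^+ 2 + y ^+ 2))) = z.
Proof. by move=> s; have s0 := lt0r_neq0 s; field. Qed.

Lemma good_std x y z : admissible x y z -> good (- br) signs (std x y z).
Proof.
move=> [S xy v1 v3 sx sy ss].
have s0 := lt0r_neq0 xy; have zE := std_z z xy; rewrite -zE in S.
split.
- elim/ord4_ind.
  + do 2!eexists; split; last reflexivity.
    rewrite oppr_eq0; case: (eqVneq x 0) v1 => [x0 /= z0|]; last by rewrite orbT.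
    rewrite orbF mulf_neq0 ?invr_eq0 // oppr_eq0 mulf_neq0 //.
    by apply: contra_neq s0 => ->; rewrite x0 !expr0n /= addr0.
  + by do 2!eexists; split; last reflexivity; rewrite oner_eq0.
  + do 2!eexists; split; last reflexivity.
    case: (eqVneq y 0) v3 => [y0 /= z0|]; last by rewrite orbT.
    rewrite orbF mulf_neq0 ?invr_eq0 // oppr_eq0 mulf_neq0 //.
    by apply: contra_neq s0 => ->; rewrite y0 !expr0n /= addr0.
  + have tr4 : \tr (val (std x y z 3)) = 2.
      rewrite [std x y z 3]/(_ * D)%g last_tr tri_tr; move: S; rewrite /surface;
        set w := - (_ + _) => S.
      apply: (eqr_lin (k := br) S); apply: (eqr_lin (k := 2) br2); ring.
    (* The sign of the fourth factor is read off at v1 or at v3, wherever [form] does not vanish. *)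
    have [sx0|] := eqVneq (er * (2 + 2 * br - x ^+ 2)) 0.
      apply: (parab_form (x := - (z * y) / (x ^+ 2 + y ^+ 2)) (y := - x)) => //.
      rewrite [std x y z 3]/(_ * D)%g last_form1 //.
      by rewrite lt_neqAle sy andbT eq_sym; move: ss; rewrite sx0 add0r.
    move=> sx0; apply: (parab_form (x := - (z * x) / (x ^+ 2 + y ^+ 2)) (y := y)) => //.
    by rewrite [std x y z 3]/(_ * D)%g last_form3 // lt_neqAle sx andbT eq_sym.
- rewrite -hD; congr (val _).
  by rewrite [LHS](_ : _ = tri_std x y z * ((tri_std x y z)^-1 * D))%g // mulgA mulgV
    mul1g.
- move=> [a [c [ac H]]].
  (* A vector fixed by the second factor is a multiple of v2; if the first and third factors fix it
     too, then x = y = 0. *)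
  have /(fixes_transv _ _ _ _ br0) [] := H 1; last by case=> /eqP; rewrite oner_eq0.
  rewrite mul0r subr0 mul1r => c0; rewrite c0 eqxx orbF in ac.
  have /(fixes_transv _ _ _ _ (oner_neq0 _)) H0 := H 0.
  have /(fixes_transv _ _ _ _ (oner_neq0 _)) H2 := H 2.
  have x0 : x = 0.
    case: H0 => [|[_ /eqP]]; last by rewrite oppr_eq0 => /eqP.
    by rewrite c0 mulr0 sub0r mulNr opprK => /eqP;
      rewrite mulf_eq0 (negbTE ac) orbF => /eqP.
  have y0 : y = 0.
    case: H2 => [|[_ //]].
    by rewrite c0 mulr0 sub0r => /eqP;
      rewrite oppr_eq0 mulf_eq0 (negbTE ac) orbF => /eqP.
  by move: xy; rewrite x0 y0 !expr0n /= addr0 ltxx.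
Qed.

Lemma good_last q : good (- br) signs q -> q 3 = ((q 0%R * q 1%R * q 2%R)^-1 * D)%g.
Proof.
move=> [_ m _]; apply: (mulgI (q 0%R * q 1%R * q 2%R)%g).
by rewrite [RHS]mulgA mulgV mul1g; apply: SL2_eqP; rewrite hD -m.
Qed.

Lemma good_standard q : good (- br) signs q ->
  exists h x y z, [/\ 0 <= x, 0 <= y, admissible x y z & conjq h q = std x y z].
Proof.
move=> G; have [p m f] := G.
have [a2 [c2 [nz2 q2]]] := p 1.
have n0 : 0 < a2 ^+ 2 + c2 ^+ 2.
  rewrite lt_neqAle addr_ge0 ?sqr_ge0 // andbT eq_sym paddr_eq0 ?sqr_ge0 //.
  by rewrite !sqrf_eq0 negb_and.
(* Replacing v1 by -v1 does not change the transvection, so x can be made nonnegative; y is treated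
   likewise through v3. *)
have [a1 [c1 [nz1 [q1 x_ge0]]]] : exists a1 c1, (a1 != 0) || (c1 != 0) /\
    q 0 = transv 1 a1 c1 /\ 0 <= a1 * c2 - c1 * a2.
  have [a1 [c1 [nz1 q1]]] := p 0.
  have [h|/ltW h] := leP 0 (a1 * c2 - c1 * a2); first by exists a1, c1.
  exists (- a1), (- c1); rewrite !oppr_eq0 transvN; split=> //; split=> //.
  by rewrite !mulNr -opprD oppr_ge0.
have [a3 [c3 [nz3 [q3 y_ge0]]]] : exists a3 c3, (a3 != 0) || (c3 != 0) /\
    q 2 = transv 1 a3 c3 /\ 0 <= a2 * c3 - c2 * a3.
  have [a3 [c3 [nz3 q3]]] := p 2.
  have [h|/ltW h] := leP 0 (a2 * c3 - c2 * a3); first by exists a3, c3.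
  exists (- a3), (- c3); rewrite !oppr_eq0 transvN; split=> //; split=> //.
  by rewrite !mulrN -opprD oppr_ge0.
set x := a1 * c2 - c1 * a2 in x_ge0; set y := a2 * c3 - c2 * a3 in y_ge0.
pose z := a3 * c1 - c3 * a1.
have T4 : parab er (q 3) := p 3.
have q4E := good_last G.
have b2 : q 1 = transv br a2 c2 := q2.
(* If x = y = 0, then v2 is fixed by the first three factors, hence by the fourth. *)
have xy : 0 < x ^+ 2 + y ^+ 2.
  rewrite lt_neqAle addr_ge0 ?sqr_ge0 // andbT eq_sym paddr_eq0 ?sqr_ge0 //.
  rewrite !sqrf_eq0; apply/negP => /andP[/eqP x0 /eqP y0]; apply: f.
  have f0 : fixes (q 0) a2 c2.
    by rewrite q1; apply/fixes_transv; [exact: oner_neq0|left; rewrite -[RHS]x0].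
  have f1 : fixes (q 1) a2 c2.
    by rewrite b2; apply/fixes_transv => //; left; ring.
  have f2 : fixes (q 2) a2 c2.
    rewrite q3; apply/fixes_transv; [exact: oner_neq0|left].
    by rewrite -[RHS]oppr0 -y0 /y; ring.
  exists a2, c2; split=> //; elim/ord4_ind => //.
  apply: (fixes_parab er0) => //.
  rewrite q4E (form_scalar _ _ _ hD) formV form_fixes ?oppr0 ?mulr0 //.
  by apply: fixesM => //; exact: fixesM.
set n := a2 ^+ 2 + c2 ^+ 2 in n0; set s := x ^+ 2 + y ^+ 2 in xy.
(* [p0] and [r0] are the first coordinates of v1 and v3 once v2 is moved to (1, 0). The unipotent
   stabiliser of (1, 0) still shifts this pair by multiples of (x, -y); [k] makes the pair
   orthogonal to (x, -y), which is the choice built into [std]. *)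
pose p0 := (a2 * a1 + c2 * c1) / n; pose r0 := (a2 * a3 + c2 * c3) / n.
pose k := (p0 * x - r0 * y) / s.
have nn := lt0r_neq0 n0; have sn := lt0r_neq0 xy.
have hdet : (a2 / n - k * c2) * a2 - (c2 / n + k * a2) * (- c2) = 1.
  by rewrite /n in nn *; field.
pose h := sl2 hdet.
have zE : - (x * r0 + y * p0) = z.
  by rewrite /r0 /p0 /x /y /z /n in nn *; field.
have h1 : (h * q 0%R * h^-1)%g = transv 1 (- (z * y) / s) (- x).
  rewrite q1 transvJ sl2E !mx2E; congr transv; last by rewrite /x; ring.
  transitivity (p0 - k * x); first by rewrite /p0 /x; ring.
  by rewrite -zE /k; rewrite /s in sn *; field.
have h2 : (h * q 1%R * h^-1)%g = transv br 1 0.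
  rewrite b2 transvJ sl2E !mx2E; congr transv; last by ring.
  by rewrite /n in nn *; field.
have h3 : (h * q 2%R * h^-1)%g = transv 1 (- (z * x) / s) y.
  rewrite q3 transvJ sl2E !mx2E; congr transv; last by rewrite /y; ring.
  transitivity (r0 + k * y); first by rewrite /r0 /y; ring.
  by rewrite -zE /k; rewrite /s in sn *; field.
have Gh := good_conj h G.
have cE : conjq h q = std x y z.
  rewrite -[LHS]q4_eta /std; congr q4 => //.
  by rewrite (good_last Gh) /tri_std /tri -h1 -h2 -h3.
exists h, x, y, z; split=> //.
have [P _ _] := Gh; rewrite cE in P.
have T4' : parab er ((tri_std x y z)^-1 * D)%g := P 3.
have S : surface x y z.
  have tr4 : \tr (val ((tri_std x y z)^-1 * D)%g) = 2.
    by have [a4 [c4 [_ ->]]] := T4'; rewrite tr_transv.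
  move: tr4; rewrite last_tr tri_tr std_z //.
  rewrite /surface => tr4; apply: (eqr_lin (k := br) tr4).
  by apply: (eqr_lin (k :=
    br * x * y * z - z ^+ 2 - br * (x ^+ 2 + y ^+ 2) + 2) br2); ring.
have Sz := S; rewrite -(std_z z xy) in Sz.
have [a4 [c4 [nz4 E4]]] := T4'.
have F3 := last_form3 Sz; rewrite -/(tri_std x y z) E4 form_transv in F3.
have F1 := last_form1 Sz; rewrite -/(tri_std x y z) E4 form_transv in F1.
split=> //.
- rewrite -negb_and; apply/negP => /andP[/eqP x0 /eqP z0].
  have : parab 1 (transv 1 (- (z * y) / s) (- x)) := P 0.
  by rewrite x0 z0 mul0r !oppr0 mul0r; apply: not_parab0; exact: oner_neq0.
- rewrite -negb_and; apply/negP => /andP[/eqP y0 /eqP z0].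
  have : parab 1 (transv 1 (- (z * x) / s) y) := P 2.
  by rewrite y0 z0 mul0r oppr0 mul0r; apply: not_parab0; exact: oner_neq0.
- by rewrite -F3 mulrA er2 mul1r sqr_ge0.
- by rewrite -F1 mulrA er2 mul1r sqr_ge0.
(* If both values vanish, v1 and v3 are parallel to v4, so z = 0; then x^2 = y^2 = 2 + 2b
   contradicts the surface equation or x^2 + y^2 > 0. *)
- rewrite -F3 -F1 !mulrA er2 !mul1r paddr_eq0 ?sqr_ge0 // !sqrf_eq0.
  apply/negP => /andP[/eqP w3 /eqP w1].
  have {}F3 : er * 0 ^+ 2 = 2 + 2 * br - x ^+ 2.
    by apply: etrans F3; congr (_ * _ ^+ 2); rewrite mulrA; exact/esym/w3.
  have {}F1 : er * 0 ^+ 2 = 2 + 2 * br - y ^+ 2.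
    by apply: etrans F1; congr (_ * _ ^+ 2); rewrite mulrA; exact/esym/w1.
  have z0 : z = 0.
    have za : z * a4 = 0.
      apply: (eqr_lin (k := - (z * x / s)) w1); apply: (eqr_lin (k := (z * y / s)) w3).
      by rewrite /s in sn *; field.
    have zc : z * c4 = 0.
      apply: (eqr_lin (k := y) w1); apply: (eqr_lin (k := x) w3).
      by rewrite /s in sn *; field.
    apply/eqP; apply: contraLR nz4 => z0; rewrite negb_or !negbK.
    by apply/andP; split; [move/eqP: za|move/eqP: zc]; rewrite mulf_eq0 (negbTE z0).
  rewrite expr0n /= mulr0 in F3; rewrite expr0n /= mulr0 in F1.
  have x2 : x ^+ 2 = 2 + 2 * br by lra.
  have y2 : y ^+ 2 = 2 + 2 * br by lra.
  move: S xy; rewrite /surface /s z0 !x2 !y2 expr0n /= mulr0 subr0 add0r.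
  case: hb => ->; rewrite ?mulr1z ?mulrN1z; lra.
Qed.
End standard.

(** * The three basic sign patterns *)

Section base_cases.
Variables (R : realType) (b e : int) (D : SL2 R).
Hypothesis hb : b = 1 \/ b = -1.
Hypothesis he : e = 1 \/ e = -1.
Hypothesis hD : val D = (- b%:~R)%:M.
Local Notation quad := ('I_4 -> SL2 R).
Implicit Types (q : quad) (x y z c : R).
Local Notation br := (b%:~R : R).
Local Notation er := (e%:~R : R).
Local Notation std := (std b D).
Local Notation G := (good (- br) (signs b e)).

Definition surface_disc x y : R :=
  (br * x * y) ^+ 2 - 4 * (br * x ^+ 2 + br * y ^+ 2 - 2 - 2 * br).

Definition surface_root (sg : R) x y : R :=
  (br * x * y + sg * Num.sqrt (surface_disc x y)) / 2.

Lemma surface_disc_sqr x y z : surface b x y z ->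
  surface_disc x y = (2 * z - br * x * y) ^+ 2.
Proof. by rewrite /surface /surface_disc => S; apply: (eqr_lin (k := - 4) S); ring. Qed.

Lemma surface_rootP x y z : surface b x y z ->
  exists2 sg, sg = 1 \/ sg = -1 & z = surface_root sg x y.
Proof.
move=> S; have E := surface_disc_sqr S.
rewrite /surface_root E sqrtr_sqr; case: (ger0P (2 * z - br * x * y)) => _.
- by exists 1; [left|field].
- by exists (-1); [right|field].
Qed.

Lemma surface_root_surface sg x y : sg = 1 \/ sg = -1 -> 0 <= surface_disc x y ->
  surface b x y (surface_root sg x y).
Proof.
move=> hsg /sqr_sqrtr; rewrite /surface /surface_root; set r := Num.sqrt _ => r2.
have sg2 : sg * sg = 1 by case: hsg => ->; ring.
rewrite /surface_disc in r2.
apply: (eqr_lin (k := 4^-1) r2); apply: (eqr_lin (k := r ^+ 2 / 4) sg2); by field.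
Qed.

Lemma transv_continuous (T : topologicalType) (k : R) (f g : T -> R) :
  continuous f -> continuous g -> continuous (fun t => transv k (f t) (g t)).
Proof.
move=> cf cg.
apply: (SL2_continuous_entries (fun t => sl2E (transvection_det k (f t) (g t)))) => t.
- by apply: cvgB; [exact: cvg_cst|apply: cvgM; [apply: cvgM;
  [exact: cvg_cst|exact: cf]|exact: cg]].
- by apply: cvgM; [exact: cvg_cst|apply: cvgM; exact: cf].
- by apply: cvgN; apply: cvgM; [exact: cvg_cst|apply: cvgM; exact: cg].
- by apply: cvgD; [exact: cvg_cst|apply: cvgM; [apply: cvgM;
  [exact: cvg_cst|exact: cf]|exact: cg]].
Qed.

Lemma std_continuous (X Y Z : R -> R) : (forall t, X t ^+ 2 + Y t ^+ 2 != 0) ->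
  continuous X -> continuous Y -> continuous Z ->
  forall i, continuous (fun t => std (X t) (Y t) (Z t) i).
Proof.
move=> s0 cX cY cZ.
have cS : continuous (fun t => (X t ^+ 2 + Y t ^+ 2)^-1).
  move=> t; apply: cvgV; first exact: s0.
  by apply: cvgD; apply: cvgM; (exact: cX || exact: cY).
have c1 : continuous (fun t =>
  transv 1 (- (Z t * Y t) / (X t ^+ 2 + Y t ^+ 2)) (- X t)).
  apply: transv_continuous => t; last by apply: cvgN; exact: cX.
  by apply: cvgM; [apply: cvgN; apply: cvgM; (exact: cZ || exact: cY)|exact: cS].
have c3 : continuous (fun t => transv 1 (- (Z t * X t) / (X t ^+ 2 + Y t ^+ 2)) (Y t)).
  apply: transv_continuous => t; last exact: cY.
  by apply: cvgM; [apply: cvgN; apply: cvgM; (exact: cZ || exact: cX)|exact: cS].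
have cc (A : SL2 R) : continuous (fun _ : R => A) by move=> t; exact: cvg_cst.
elim/ord4_ind; [exact: c1|exact: cc|exact: c3|].
apply: SL2_mul_continuous; last exact: cc.
apply: SL2_inv_continuous; apply: SL2_mul_continuous; last exact: c3.
by apply: SL2_mul_continuous; [exact: c1|exact: cc].
Qed.

Lemma surface_root_continuous sg (X Y : R -> R) :
  continuous X -> continuous Y -> continuous (fun t => surface_root sg (X t) (Y t)).
Proof.
move=> cX cY.
have cxy : continuous (fun t => br * X t * Y t).
  by move=> t; apply: cvgM; [apply: cvgM; [exact: cvg_cst|exact: cX]|exact: cY].
have cd : continuous (fun t => surface_disc (X t) (Y t)).
  move=> t; apply: cvgB; first by apply: cvgM; exact: cxy.
  apply: cvgM; first exact: cvg_cst.
  apply: cvgB; last exact: cvg_cst.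
  apply: cvgB; last exact: cvg_cst.
  by apply: cvgD; (apply: cvgM; [exact: cvg_cst|apply: cvgM; (exact: cX || exact: cY)]).
move=> t; apply: cvgM; last exact: cvg_cst.
apply: cvgD; first exact: cxy.
apply: cvgM; first exact: cvg_cst.
by apply: (@continuous_comp _ _ _ (fun t => surface_disc (X t) (Y t)) Num.sqrt);
  [exact: cd|exact: sqrt_continuous].
Qed.

(** [P] is the convex set of pairs (x, y) that occur with x and y nonnegative; over it each sign
    [sg] gives one sheet of the surface. *)
Variable P : R -> R -> Prop.
Hypothesis P_segment : forall x0 y0 x1 y1 c, P x0 y0 -> P x1 y1 -> 0 <= c -> c <= 1 ->
  P ((1 - c) * x0 + c * x1) ((1 - c) * y0 + c * y1).
Hypothesis P_admissible : forall sg x y, sg = 1 \/ sg = -1 -> P x y ->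
  admissible b e x y (surface_root sg x y).

Lemma linked_sheet sg x0 y0 x1 y1 : sg = 1 \/ sg = -1 -> P x0 y0 -> P x1 y1 ->
  linked G (std x0 y0 (surface_root sg x0 y0)) (std x1 y1 (surface_root sg x1 y1)).
Proof.
move=> hsg P0 P1.
(* The squared sine parametrises the segment by the whole line, as [linked_path] asks; it is 0 at 0
   and 1 at pi / 2. *)
pose c (t : R) := sin t ^+ 2.
pose X t := (1 - c t) * x0 + c t * x1; pose Y t := (1 - c t) * y0 + c t * y1.
have cc : continuous c by move=> t; apply: cvgM; exact: continuous_sin.
have cX : continuous X.
  move=> t; apply: cvgD; apply: cvgM; (try exact: cvg_cst); last exact: cc.
  by apply: cvgB; [exact: cvg_cst|exact: cc].
have cY : continuous Y.
  move=> t; apply: cvgD; apply: cvgM; (try exact: cvg_cst); last exact: cc.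
  by apply: cvgB; [exact: cvg_cst|exact: cc].
have PXY t : P (X t) (Y t).
  apply: P_segment => //; first exact: sqr_ge0.
  by rewrite /c -(cos2Dsin2 t) lerDr sqr_ge0.
pose g t := std (X t) (Y t) (surface_root sg (X t) (Y t)).
have -> : std x0 y0 (surface_root sg x0 y0) = g 0.
  by rewrite /g /X /Y /c sin0 expr0n /= !subr0 !mul0r !addr0 !mul1r.
have -> : std x1 y1 (surface_root sg x1 y1) = g (pi / 2).
  by rewrite /g /X /Y /c sin_pihalf expr1n !subrr !mul0r !add0r !mul1r.
apply: linked_path.
- apply: std_continuous => //; last exact: surface_root_continuous.
  by move=> t; apply: lt0r_neq0; have [] := P_admissible hsg (PXY t).
- by move=> t; apply: good_std => //; exact: P_admissible.
Qed.

Hypothesis admissible_P : forall x y z, 0 <= x -> 0 <= y -> admissible b e x y z ->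
  P x y.
(** Over (xb, yb) the two sheets give the same quadruple, though not necessarily the same z. *)
Variables xb yb : R.
Hypothesis P_base : P xb yb.
Hypothesis base_eq :
  std xb yb (surface_root (-1) xb yb) = std xb yb (surface_root 1 xb yb).

(** Any good quadruple is conjugated into normal form and then moved along its sheet to the base
    point, where both sheets agree. *)
Lemma conn_base : conn (- br) (signs b e).
Proof.
have toB q : G q -> linked G q (std xb yb (surface_root 1 xb yb)).
  move=> Gq; have [h [x [y [z [x0 y0 adm E]]]]] := good_standard hb he hD Gq.
  apply: linked_trans (linked_conj h Gq) _; rewrite E.
  have [sg hsg ->] := surface_rootP (adm_surface adm).
  have := linked_sheet hsg (admissible_P x0 y0 adm) P_base.
  by case: hsg => ->; rewrite ?base_eq.
split.
  exists (std xb yb (surface_root 1 xb yb)); apply: good_std => //.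
  by apply: P_admissible => //; left.
by move=> q q' /toB h /toB h'; apply: linked_trans h (linked_sym h').
Qed.
End base_cases.

(** * Domains and base points for ++++, +++- and +-+- *)

Section three_cases.
Variable R : realType.
Implicit Types x y z c : R.

Let val_opp1 : val (SL2_opp 1%g : SL2 R) = (- (1 : int)%:~R)%:M.
Proof. by rewrite /= mulr1z raddfN. Qed.

Let val_one : val (1%g : SL2 R) = (- (-1 : int)%:~R)%:M.
Proof. by rewrite SL2_val1 mulrN1z opprK. Qed.

Lemma convex_gt (k u v c : R) : 0 <= c -> c <= 1 -> k <= u -> k <= v ->
  k <= (1 - c) * u + c * v.
Proof. by move=> *; nra. Qed.

Lemma convex_lt (k u v c : R) : 0 <= c -> c <= 1 -> u <= k -> v <= k ->
  (1 - c) * u + c * v <= k.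
Proof. by move=> *; nra. Qed.

(** The square [0, 2]^2 without its corners: [adm_xy] fails at (0, 0), [adm_s] at (2, 2), and at the
    other two the surface forces z = 0, so that [adm_v1] or [adm_v3] fails. *)
Definition dom_pppp x y : Prop :=
  [/\ 0 <= x <= 2, 0 <= y <= 2 & (0 < x < 2) \/ (0 < y < 2)].

Lemma segment_cases (c : R) : 0 <= c -> c <= 1 -> [\/ c = 0, c = 1 | 0 < c < 1].
Proof.
rewrite le_eqVlt => /orP[/eqP <-|c0]; first by constructor 1.
rewrite le_eqVlt => /orP[/eqP ->|c1]; first by constructor 2.
by constructor 3; rewrite c0.
Qed.

(** A coordinate strictly between 0 and 2 at one end remains so at every interior point of the
    segment, so no corner is met. *)
Lemma dom_pppp_segment x0 y0 x1 y1 c : dom_pppp x0 y0 -> dom_pppp x1 y1 ->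
  0 <= c -> c <= 1 -> dom_pppp ((1 - c) * x0 + c * x1) ((1 - c) * y0 + c * y1).
Proof.
move=> [/andP[a1 a2] /andP[a3 a4] a5] [/andP[b1 b2] /andP[b3 b4] b5] c0 c1; split.
- by apply/andP; split; [exact: convex_gt|exact: convex_lt].
- by apply/andP; split; [exact: convex_gt|exact: convex_lt].
- have [->|->|/andP[{}c0 {}c1]] := segment_cases c0 c1.
  + by rewrite subr0 !mul1r !mul0r !addr0.
  + by rewrite subrr !mul0r !mul1r !add0r.
  + by case: a5 => /andP[h1 h2]; [left|right]; apply/andP; split; nra.
Qed.

Lemma surface_disc_prod x y : surface_disc 1 x y = (4 - x ^+ 2) * (4 - y ^+ 2).
Proof. by rewrite /surface_disc mulr1z; ring. Qed.

Lemma dom_pppp_admissible x y z : 0 <= x -> 0 <= y -> admissible 1 1 x y z ->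
  dom_pppp x y.
Proof.
move=> x0 y0 [S xy v1 v3 sx sy ss].
rewrite /surface !mulr1z in S sx sy ss.
have x2 : x <= 2 by nra.
have y2 : y <= 2 by nra.
split; rewrite ?x0 ?y0 //.
move: x0 y0 x2 y2; rewrite !le_eqVlt.
move=> /orP[/eqP x0|x0] /orP[/eqP y0|y0] /orP[/eqP x2|x2] /orP[/eqP y2|y2];
  try (by left; rewrite x0 x2); try (by right; rewrite y0 y2); exfalso.
all: move: S xy v1 v3 ss; rewrite -?x0 -?y0 ?x2 ?y2 ?eqxx /= => S xy v1 v3 ss; try lra.
all: try (by move: ss; rewrite (_ : _ + _ = 0) ?eqxx //; lra).
all: try (by move: v1; rewrite -sqrf_eq0 (_ : z ^+ 2 = 0) ?eqxx //; lra).
all: try (by move: v3; rewrite -sqrf_eq0 (_ : z ^+ 2 = 0) ?eqxx //; lra).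
Qed.

Lemma conn_pppp : conn (-1 : R) (q4 1 1 1 1).
Proof.
have := @conn_base R 1 1 _ (or_introl erefl) (or_introl erefl) val_opp1 dom_pppp
  dom_pppp_segment.
(* At x = 2 the discriminant (4 - x^2)(4 - y^2) vanishes, so the two roots coincide. *)
rewrite mulr1z => /(_ _ _ 2 1); apply.
- move=> sg x y hsg [/andP[a1 a2] /andP[a3 a4] a5].
  have x4 : x ^+ 2 <= 4 by nra.
  have y4 : y ^+ 2 <= 4 by nra.
  have D0 : 0 <= surface_disc 1 x y.
    by rewrite surface_disc_prod mulr_ge0 // subr_ge0.
  have S := surface_root_surface hsg D0; split; rewrite ?mulr1z //.
  + by case: a5 => /andP[? ?]; nra.
  + rewrite -negb_and; apply/negP => /andP[/eqP x0 /eqP z0].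
    move: S; rewrite /surface z0 x0 mulr1z => S.
    by case: a5 => /andP[? ?]; nra.
  + rewrite -negb_and; apply/negP => /andP[/eqP y0 /eqP z0].
    move: S; rewrite /surface z0 y0 mulr1z => S.
    by case: a5 => /andP[? ?]; nra.
  + by lra.
  + by lra.
  + by apply: lt0r_neq0; case: a5 => /andP[? ?]; nra.
- exact: dom_pppp_admissible.
- by split; [|lra|right]; lra.
- by rewrite /surface_root surface_disc_prod (_ : 4 - 2 ^+ 2 = 0) ?mul0r ?sqrtr0
  ?mulr0 //; ring.
Qed.

(** The negative fourth sign reverses the bounds on x and y, so both factors of the discriminant are
    nonpositive; (2, 2) is excluded by [adm_s]. *)
Definition dom_pppm x y : Prop := [/\ 2 <= x, 2 <= y & 2 < x \/ 2 < y].

Lemma dom_pppm_segment x0 y0 x1 y1 c : dom_pppm x0 y0 -> dom_pppm x1 y1 ->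
  0 <= c -> c <= 1 -> dom_pppm ((1 - c) * x0 + c * x1) ((1 - c) * y0 + c * y1).
Proof.
move=> [a1 a2 a3] [b1 b2 b3] c0 c1; split; [exact: convex_gt|exact: convex_gt|].
have [->|->|/andP[{}c0 {}c1]] := segment_cases c0 c1.
- by rewrite subr0 !mul1r !mul0r !addr0.
- by rewrite subrr !mul0r !mul1r !add0r.
- by case: a3 => h; [left|right]; nra.
Qed.

Lemma conn_pppm : conn (-1 : R) (q4 1 1 1 (-1)).
Proof.
have := @conn_base R 1 (-1) _ (or_introl erefl) (or_intror erefl) val_opp1 dom_pppm
  dom_pppm_segment.
rewrite mulr1z => /(_ _ _ 2 3); apply.
- move=> sg x y hsg [a1 a2 a3].
  have x4 : 4 <= x ^+ 2 by nra.
  have y4 : 4 <= y ^+ 2 by nra.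
  have D0 : 0 <= surface_disc 1 x y.
    by rewrite surface_disc_prod mulr_le0 // subr_le0.
  have S := surface_root_surface hsg D0; split; rewrite ?mulr1z ?mulrN1z //.
  + by lra.
  + by rewrite lt0r_neq0 //; lra.
  + by rewrite lt0r_neq0 //; lra.
  + by lra.
  + by lra.
  + by apply: lt0r_neq0; case: a3 => ?; nra.
- move=> x y z x0 y0 [S xy v1 v3 sx sy ss].
  rewrite !mulr1z !mulrN1z in sx sy ss.
  have x2 : 2 <= x by nra.
  have y2 : 2 <= y by nra.
  split=> //; move: x2 y2; rewrite !le_eqVlt => /orP[/eqP x2|]; last by left.
  move=> /orP[/eqP y2|]; last by right.
  by exfalso; move: ss; rewrite -x2 -y2 (_ : _ + _ = 0) ?eqxx //; lra.
- by split; [| |right]; lra.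
- by rewrite /surface_root surface_disc_prod (_ : 4 - 2 ^+ 2 = 0) ?mul0r ?sqrtr0
  ?mulr0 //; ring.
Qed.

Definition dom_pmpm x y : Prop := [/\ 0 <= x, 0 <= y & 0 < x \/ 0 < y].

Lemma dom_pmpm_segment x0 y0 x1 y1 c : dom_pmpm x0 y0 -> dom_pmpm x1 y1 ->
  0 <= c -> c <= 1 -> dom_pmpm ((1 - c) * x0 + c * x1) ((1 - c) * y0 + c * y1).
Proof.
move=> [a1 a2 a3] [b1 b2 b3] c0 c1; split; [exact: convex_gt|exact: convex_gt|].
have [->|->|/andP[{}c0 {}c1]] := segment_cases c0 c1.
- by rewrite subr0 !mul1r !mul0r !addr0.
- by rewrite subrr !mul0r !mul1r !add0r.
- by case: a3 => h; [left|right]; nra.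
Qed.

Lemma surface_discN1 x y :
  surface_disc (-1) x y = (x * y) ^+ 2 + 4 * x ^+ 2 + 4 * y ^+ 2.
Proof. by rewrite /surface_disc mulrN1z; ring. Qed.

Lemma conn_pmpm : conn (1 : R) (q4 1 (-1) 1 (-1)).
Proof.
have := @conn_base R (-1) (-1) _ (or_intror erefl) (or_intror erefl) val_one dom_pmpm
  dom_pmpm_segment.
(* The discriminant is positive away from the origin, so the sheets are disjoint; over (0, 1) they
   have z = 1 and z = -1, and the two quadruples of vectors differ only by replacing v1 with -v1. *)
rewrite mulrN1z opprK => /(_ _ _ 0 1); apply.
- move=> sg x y hsg [a1 a2 a3].
  have x4 : 0 <= x ^+ 2 by exact: sqr_ge0.
  have y4 : 0 <= y ^+ 2 by exact: sqr_ge0.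
  have xy : 0 < x ^+ 2 + y ^+ 2 by case: a3 => ?; nra.
  have D0 : 0 <= surface_disc (-1) x y.
    by rewrite surface_discN1; have := sqr_ge0 (x * y); lra.
  have S := surface_root_surface hsg D0; split; rewrite ?mulrN1z //.
  + rewrite -negb_and; apply/negP => /andP[/eqP x0 /eqP z0].
    by move: S; rewrite /surface z0 x0 mulrN1z => S; rewrite x0 in xy; lra.
  + rewrite -negb_and; apply/negP => /andP[/eqP y0 /eqP z0].
    by move: S; rewrite /surface z0 y0 mulrN1z => S; rewrite y0 in xy; lra.
  + by lra.
  + by lra.
  + by apply: lt0r_neq0; lra.
- move=> x y z x0 y0 [S xy v1 v3 sx sy ss]; split=> //.
  move: x0 y0; rewrite !le_eqVlt => /orP[/eqP x0|]; last by left.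
  move=> /orP[/eqP y0|]; last by right.
  by move: xy; rewrite -x0 -y0 !expr0n /= addr0 ltxx.
- by split; [| |right]; lra.
- have sd : surface_disc (-1) 0 1 = 2 ^+ 2 :> R by rewrite surface_discN1; ring.
  have -> : surface_root (-1) (-1) 0 1 = -1 :> R.
    by rewrite /surface_root sd sqrtr_sqr normr_nat mulrN1z; field.
  have -> : surface_root (-1) 1 0 1 = 1 :> R.
    by rewrite /surface_root sd sqrtr_sqr normr_nat mulrN1z; field.
  have E1 : transv 1 (- (-1 * 1) / (0 ^+ 2 + 1 ^+ 2)) (- 0) =
            transv 1 (- (1 * 1) / (0 ^+ 2 + 1 ^+ 2)) (- 0) :> SL2 R.
    rewrite -[RHS]transvN; congr transv; last by rewrite opprK oppr0.
    by rewrite !mulr1 !mulNr !opprK.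
  have E3 : transv 1 (- (-1 * 0) / (0 ^+ 2 + 1 ^+ 2)) 1 =
            transv 1 (- (1 * 0) / (0 ^+ 2 + 1 ^+ 2)) 1 :> SL2 R.
    by rewrite !mulr0.
  by rewrite /std /tri_std /tri E1 E3.
Qed.
End three_cases.

(** * From quadruples to the moduli space *)

Section rep_of.
Variable R : realType.
Local Notation quad := ('I_4 -> SL2 R).
Implicit Types (A B T h : SL2 R) (q : quad) (u v : word).

Definition cls A : PSL2 R := \pi_(PSL2 R) A.

Lemma pi_mul A B : cls (A * B)%g = (cls A * cls B)%g.
Proof. exact/esym/PSL2_mulE. Qed.

Lemma pi_inv A : cls A^-1%g = (cls A)^-1%g.
Proof. exact/esym/PSL2_invE. Qed.

Definition letter q (x : 'I_4 * bool) : SL2 R :=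
  if x.2 then (q x.1)^-1%g else q x.1.

Definition word_val q (u : word) : SL2 R := foldr (fun x A => letter q x * A)%g 1%g u.

Lemma word_val_cat q u v : word_val q (u ++ v) = (word_val q u * word_val q v)%g.
Proof. by elim: u => [|x u IH] /=; rewrite ?mul1g // IH mulgA. Qed.

Definition central q : Prop := cls (q 0%R * q 1%R * q 2%R * q 3%R)%g = 1%g.

Lemma enum_ord4 : enum 'I_4 = [:: 0; 1; 2; 3].
Proof. by apply: (inj_map val_inj); rewrite val_enum_ord. Qed.

Lemma word_val_eq q u v : central q -> word_eq u v ->
  cls (word_val q u) = cls (word_val q v).
Proof.
move=> cq; elim=> //.
- by move=> a b c _ -> _ ->.
- by move=> a a' b b' _ h1 _ h2; rewrite !word_val_cat !pi_mul h1 h2.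
- by move=> i [] /=; rewrite /letter /= !mulg1 ?mulgV ?mulVg.
- by rewrite enum_ord4 /= /letter /= mulg1 !mulgA.
Qed.

(** The value is computed on a chosen word of each class; by [rep_ofE] the choice is immaterial once
    [q] is [central]. *)
Definition rep_of q : rep_space R := fun g => cls (word_val q (repr g)).

Lemma rep_ofE q u : central q -> rep_of q (\pi_pi1 u) = cls (word_val q u).
Proof. by move=> cq; apply: word_val_eq => //; exact: pi1_reprP. Qed.

Lemma rep_of_loop q i : central q -> rep_of q (puncture_loop i) = cls (q i).
Proof. by move=> cq; rewrite rep_ofE //= /letter /= mulg1. Qed.

Lemma rep_of_rep q : central q -> representation (rep_of q).
Proof.
move=> cq g h; rewrite -[g]reprK -[h]reprK.
rewrite [(_ * _)%g](_ : _ = \pi_pi1 (repr g ++ repr h)); last exact: pi1_mulE.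
by rewrite !rep_ofE // word_val_cat pi_mul.
Qed.

Lemma rep1 (rho : rep_space R) : representation rho -> rho 1%g = 1%g.
Proof.
move=> hr; apply: (mulgI (rho 1%g)).
by rewrite -hr !mulg1.
Qed.

Lemma repV (rho : rep_space R) g : representation rho -> rho g^-1%g = (rho g)^-1%g.
Proof.
by move=> hr; apply: (mulgI (rho g)); rewrite -hr !mulgV rep1.
Qed.

Lemma pi1_relation : (puncture_loop 0%R * puncture_loop 1%R * puncture_loop 2%R *
  puncture_loop 3%R = 1)%g.
Proof.
have E u v : ((\pi_pi1 u : pi1) * (\pi_pi1 v : pi1))%g = \pi_pi1 (u ++ v) :=
  pi1_mulE u v.
rewrite /puncture_loop !E.
by apply/pi1_eqP; have := word_eq_relator; rewrite enum_ord4.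
Qed.

Lemma rep_ofP (rho : rep_space R) q : representation rho ->
  (forall i, cls (q i) = rho (puncture_loop i)) ->
  central q /\ rho = rep_of q.
Proof.
move=> hr hq.
have cq : central q.
  by rewrite /central !pi_mul !hq -!hr pi1_relation rep1.
split=> //; apply/funext => g; rewrite -[g]reprK rep_ofE //.
elim: (repr g) => [|[i b] u IH]; first exact: rep1.
rewrite -cat1s word_val_cat pi_mul -IH.
rewrite [X in rho X](_ : _ = ((\pi_pi1 [:: (i, b)] : pi1) * (\pi_pi1 u : pi1))%g);
  last exact/esym/pi1_mulE.
rewrite hr; congr (_ * _)%g; rewrite /= mulg1 /letter /=; case: b.
  by rewrite pi_inv hq -repV //; congr rho; rewrite [RHS]pi1_invE.
by rewrite hq.
Qed.

Lemma rep_of_conj h q g : central q -> central (conjq h q) ->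
  rep_of (conjq h q) g = (cls h * rep_of q g * (cls h)^-1)%g.
Proof.
move=> cq ch; rewrite -[g]reprK !rep_ofE // -pi_inv -!pi_mul; congr cls.
elim: (repr g) => [|[i b] u IH] /=; first by rewrite mulg1 mulgV.
rewrite IH /letter /=; case: b; rewrite /conjq ?invgM ?invgK !mulgA ?mulgVK //.
Qed.

Lemma word_val_continuous (g : R -> quad) u : (forall i, continuous (g ^~ i)) ->
  continuous (fun t => word_val (g t) u).
Proof.
move=> gc; elim: u => [|[i b] u IH] /=; first by move=> t; exact: cvg_cst.
apply: SL2_mul_continuous => //; rewrite /letter /=; case: b; last exact: gc.
exact: SL2_inv_continuous.
Qed.

Lemma rep_of_continuous (g : R -> quad) : (forall i, continuous (g ^~ i)) ->
  continuous (fun t => rep_of (g t)).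
Proof.
move=> gc t; apply/compact_open_cvgP => K O /compact_near_coveringP cK oO sub.
suff : \forall s \near t, K `<=` (fun x => O (rep_of (g s) x)).
  by apply: filterS => s hs _ [x Kx <-]; exact: hs.
(* Compactness of [K], in its near-covering form, reduces the claim to one point of [K] at a time;
   in the discrete topology {x} is a neighbourhood of x. *)
apply: (cK R (nbhs t) (fun s x => O (rep_of (g s) x)) (nbhs_filter t)) => x Kx.
have c : continuous (fun s => rep_of (g s) x).
  move=> s; apply: (@continuous_comp _ _ _ (fun s => word_val (g s) (repr x)) cls).
    exact: word_val_continuous.
  exact: pi_continuous.
have h : \forall s \near t, O (rep_of (g s) x).
  by apply: c; apply: open_nbhs_nbhs; split=> //; apply: sub; exists x.
exists ([set x], [set s | O (rep_of (g s) x)]) => /=.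
  by split=> //; exact: (@discrete_set1 (discrete_topology pi1)).
by move=> [y s] /= [-> ].
Qed.
End rep_of.

(** * Connected components of the moduli space *)

Section moduli_connected.
Variables (R : realType) (k : int) (s : 'I_4 -> int) (d : R).
Hypothesis hd : d = 1 \/ d = -1.
Hypothesis good_rep : forall q, good d s q -> type_preserving_reps k s (rep_of q).
Hypothesis rep_good : forall rho : rep_space R, type_preserving_reps k s rho ->
  exists q, good d s q /\ rho = rep_of q.
Implicit Types q : 'I_4 -> SL2 R.

Lemma cls_scalar (A : SL2 R) (c : R) : c = 1 \/ c = -1 -> val A = c%:M -> cls A = 1%g.
Proof.
move=> hc h; apply/PSL2_eqP; case: hc => E; [left|right]; apply: SL2_eqP.
- by rewrite h E.
- by rewrite h E /= raddfN.
Qed.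

Lemma good_central q : good d s q -> central q.
Proof. by move=> [_ m _]; exact: cls_scalar m. Qed.

Lemma linked_good q q' : linked (good d s) q q' -> good d s q /\ good d s q'.
Proof.
elim=> //.
- by move=> h p Gp; split=> //; exact: good_conj.
- by move=> p p' _ [].
- by move=> p p' p'' _ [? _] _ [_ ?].
Qed.

Definition rep_point q (G : good d s q) : type_preserving_reps (R := R) k s :=
  exist _ (rep_of q) (mem_set (good_rep G)).

Definition mod_point q (G : good d s q) : moduli R k s :=
  \pi_(moduli R k s) (rep_point G).

Lemma mod_point_irr q (G G' : good d s q) : mod_point G = mod_point G'.
Proof. by congr (\pi_(moduli R k s) _); exact: val_inj. Qed.

Lemma connected_RT : connected [set: R].
Proof. by apply/connected_intervalP. Qed.

(** A path gives a continuous image of the real line, and a conjugation does not move the point. The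
    proofs [G] and [G'] are arbitrary because [mod_point] takes one as an argument. *)
Lemma linked_component q q' : linked (good d s) q q' ->
  forall (G : good d s q) (G' : good d s q'),
    connected_component [set: moduli R k s] (mod_point G) (mod_point G').
Proof.
elim.
- move=> g a b gc gG G G'.
  exists ((fun t => mod_point (gG t)) @` [set: R]).
    split=> //.
      by exists a => //; exact: mod_point_irr.
    apply: connected_continuous_connected; first exact: connected_RT.
    apply: continuous_subspaceT => t.
    apply: (@continuous_comp _ _ _ (fun t => rep_point (gG t)) \pi_(moduli R k s)).
      apply: continuous_comp_initial => t'.
      exact: rep_of_continuous gc t'.
    exact: pi_continuous.
  by exists b => //; exact: mod_point_irr.
- move=> h p Gp G G'.
  have -> : mod_point G' = mod_point G.
    apply/esym/eqquotP/asboolP; exists (cls h) => g.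
    by rewrite /= rep_of_conj //; exact: good_central.
  exact: connected_component_refl.
- by move=> p p' _ IH G G'; apply: connected_component_sym; exact: IH.
- move=> p p' p'' l1 IH1 l2 IH2 G G''; have [_ G'] := linked_good l1.
  exact: connected_component_trans (IH1 G G') (IH2 G' G'').
Qed.

Lemma moduli_of_conn : conn d s ->
  [set: moduli R k s] !=set0 /\ connected [set: moduli R k s].
Proof.
move=> [[q Gq] H]; split; first by exists (mod_point Gq).
have surj (m : moduli R k s) : exists q (G : good d s q), m = mod_point G.
  rewrite -[m]reprK; case: (repr m) => rho hrho.
  have [p [Gp E]] := rep_good (set_mem hrho).
  by exists p, Gp; congr (\pi_(moduli R k s) _); apply: val_inj.
rewrite (_ : [set: moduli R k s] = connected_component [set: moduli R k s] (mod_point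
  Gq)).
  exact: component_connected.
apply/seteqP; split=> // m _; have [p [Gp ->]] := surj m.
exact: linked_component (H _ _ Gq Gp) Gq Gp.
Qed.
End moduli_connected.

(** * Zariski density *)

Section zariski.
Import (canonicals) mpoly.
Variable R : realType.
Implicit Types (A B T h : SL2 R) (q : 'I_4 -> SL2 R) (a c x y t : R).

Lemma meval_affine n (p : mpoly.mpoly n R) (u v : 'I_n -> R) :
  exists r : {poly R}, forall t, mpoly.meval (fun i => u i + v i * t) p = r.[t].
Proof.
elim/mpoly.mpolyind: p => [|k m p _ _ [r hr]].
  by exists 0 => t; rewrite mpoly.meval0 horner0.
exists (k *: \prod_i ((u i)%:P + 'X * (v i)%:P) ^+ (mpoly.fun_of_multinom m i) + r)
  => t.
rewrite mpoly.mevalD mpoly.mevalZ mpoly.mevalX hr hornerD hornerZ horner_prod.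
congr (_ * _ + _); apply: eq_bigr => i _.
by rewrite horner_exp !hornerE mulrC.
Qed.

Lemma poly_vanish (r : {poly R}) (e : R) : e != 0 ->
  (forall n : nat, r.[n%:R * e] = 0) -> r = 0.
Proof.
move=> e0 hr; apply/eqP; apply/negPn/negP => r0.
have := @max_poly_roots _ r [seq n%:R * e | n <- iota 0 (size r)] r0.
rewrite size_map size_iota ltnn => h; apply/notF/h.
  by apply/allP => _ /mapP[n _ ->]; rewrite rootE hr.
rewrite map_inj_uniq ?iota_uniq // => m n /(mulIf e0) /eqP.
by rewrite eqr_nat => /eqP.
Qed.

Definition vanishes (p : mpoly.mpoly (2 * 2) R) A : Prop :=
  mpoly.meval (mxvec (val A) 0) p = 0.

(** The entries of A (I + t N) B are affine in t, so [p] restricts to a polynomial in one variable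
    with infinitely many roots n e. This passes from the powers of a transvection to its
    one-parameter group. *)
Lemma vanishes_line p e a c A B (F : R -> SL2 R) :
  (forall t, F t = A * transv t a c * B)%g -> e != 0 ->
  (forall n : nat, vanishes p (F (n%:R * e))) -> forall t, vanishes p (F t).
Proof.
move=> FE e0 H t.
pose N : 'M[R]_2 := mx2 (- (a * c)) (a ^+ 2) (- (c ^+ 2)) (a * c).
have E s : val (F s) = val A *m val B + s *: (val A *m N *m val B).
  rewrite FE.
  change (val A *m transvection s a c *m val B = val A *m val B + s *: (val A *m N *m
    val B)).
  rewrite (_ : transvection s a c = 1%:M + s *: N); last first.
    by apply: mx2P; rewrite !mxE /= ?mulr1n ?mulr0n; ring.
  by rewrite mulmxDr mulmx1 mulmxDl -scalemxAr -scalemxAl.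
have [r hr] := meval_affine p (mxvec (val A *m val B) 0) (mxvec (val A *m N *m val B)
  0).
have V s : mpoly.meval (mxvec (val (F s)) 0) p = r.[s].
  rewrite -hr; congr (mpoly.meval _ p); apply/funext => k.
  by rewrite E linearD linearZ [LHS]mxE; congr (_ + _); rewrite mxE mulrC.
have r0 : r = 0 by apply: (poly_vanish e0) => n; rewrite -V; exact: H.
by rewrite /vanishes V r0 horner0.
Qed.

Lemma transvD (s t a c : R) : (transv s a c * transv t a c)%g = transv (s + t) a c.
Proof. by apply: SL2_eqP; apply: mx2P; rewrite !SL2_valM !sl2E !mx2E; ring. Qed.

Lemma transv0 a c : transv 0 a c = 1%g.
Proof. by apply: SL2_eqP; apply: mx2P; rewrite !sl2E !mx2E !scalar_mx2; ring. Qed.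

Lemma word_val_nseq q i e a c n : q i = transv e a c ->
  word_val q (nseq n (i, false)) = transv (n%:R * e) a c.
Proof.
move=> qi; elim: n => [|n IH] /=; first by rewrite mul0r transv0.
by rewrite IH /letter /= qi transvD -natr1; congr transv; ring.
Qed.

(** A matrix with nonzero lower left entry is an upper times a lower times an upper unipotent. If
    that entry is 0, multiplying by a lower unipotent makes it nonzero. *)
Lemma four_unipotents w A : w != 0 -> exists t1 t2 t3 t4, A =
  (transv t1 1 0 * transv t2 0 w * transv t3 1 0 * transv t4 0 w)%g.
Proof.
move=> w0.
have step B : val B 1 0 != 0 -> exists t1 t2 t3, B =
    (transv t1 1 0 * transv t2 0 w * transv t3 1 0)%g.
  move=> c0; have hd := SL2_det2 B.
  exists ((val B 0 0 - 1) / val B 1 0), (- val B 1 0 / w ^+ 2), ((val B 1 1 - 1) /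
    val B 1 0).
  apply: SL2_eqP; apply: mx2P; rewrite !SL2_valM !sl2E !mx2E; try by field;
    rewrite ?c0 ?w0.
  by apply: (eqr_lin (k := - (val B 1 0)^-1) hd); field; rewrite ?c0 ?w0.
have [c0|c0] := eqVneq (val A 1 0) 0; last first.
  have [t1 [t2 [t3 E]]] := step _ c0; exists t1, t2, t3, 0.
  by rewrite transv0 mulg1.
have d0 : val A 1 1 != 0.
  by have := SL2_det2 A; rewrite c0 mulr0 subr0; apply: contra_eq_neq => ->;
    rewrite mulr0 eq_sym oner_eq0.
have [|t1 [t2 [t3 E]]] := step (A * transv (-1) 0 w)%g.
  by rewrite SL2_valM !sl2E !mx2E c0 mul0r add0r mulNr opprK mul1r mulf_neq0 //
    expf_neq0.
exists t1, t2, t3, 1; rewrite -E -mulgA transvD addNr transv0 mulg1 //.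
Qed.

Lemma two_transv_generate a1 c1 a2 c2 A : a1 * c2 - c1 * a2 != 0 ->
  exists t1 t2 t3 t4, A =
  (transv t1 a1 c1 * transv t2 a2 c2 * transv t3 a1 c1 * transv t4 a2 c2)%g.
Proof.
set w := _ - _ => w0.
(* This matrix sends (1, 0) and (0, w) to (a1, c1) and (a2, c2). *)
have hdet : a1 * (c2 / w) - (a2 / w) * c1 = 1 by rewrite /w in w0 *; field.
pose g := sl2 hdet.
have g1 t : (g * transv t 1 0 * g^-1)%g = transv t a1 c1.
  by rewrite transvJ !sl2E !mx2E !mulr1 !mulr0 !addr0.
have g2 t : (g * transv t 0 w * g^-1)%g = transv t a2 c2.
  by rewrite transvJ !sl2E !mx2E !mulr0 !add0r !divfK.
have [t1 [t2 [t3 [t4 E]]]] := four_unipotents (g^-1 * A * g)%g w0.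
exists t1, t2, t3, t4; rewrite -!g1 -!g2 !mulgA !mulgVK.
rewrite -(mulgA _ (transv t4 0 w)).
have -> : A = (g * (g^-1 * A * g) * g^-1)%g by rewrite !mulgA mulgV mul1g mulgK.
by rewrite E !mulgA.
Qed.

Lemma cls_closed (Z : set (PSL2 R)) (S : set (mpoly.mpoly (2 * 2) R)) A :
  [set A : SL2 R | Z (cls A)] =
    [set A : SL2 R | forall p, S p -> mpoly.meval (mxvec (val A) 0) p = 0] ->
  Z (cls A) <-> (forall p, S p -> vanishes p A).
Proof. by move=> E; split=> [h|h];
  [have : [set A : SL2 R | Z (cls A)] A by [] | change ([set A : SL2 R | Z (cls A)]
    A)]; rewrite E. Qed.

(** A polynomial vanishing on the image vanishes on the products of four powers of two generators
    with independent vectors. One exponent after another can be made real, and the resulting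
    products fill SL2. *)
Lemma rep_of_dense d e q : d = 1 \/ d = -1 -> (forall i, e i != 0) -> good d e q ->
  zariski_dense (range (rep_of q)).
Proof.
move=> hd e0 [P m f] Z [S hS] sub.
have cq : central q by exact: cls_scalar hd m.
have [a1 [c1 [nz q0]]] := P 0.
(* If all vectors were parallel to the first one, it would be a common fixed vector. *)
have : exists j a2 c2, q j = transv (e j)%:~R a2 c2 /\ a1 * c2 - c1 * a2 != 0.
  apply: contrapT => no; apply: f; exists a1, c1; split=> // j.
  have [a2 [c2 [_ qj]]] := P j; rewrite qj; apply/fixes_transv;
    first by rewrite intr_eq0.
  left; apply/eqP; apply/negPn/negP => h; apply: no; exists j, a2, c2; split=> //.
  by rewrite -oppr_eq0 opprB; apply: contra_neq h => <-; ring.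
move=> [j [a2 [c2 [qj w0]]]].
have ee i : (e i)%:~R != 0 :> R by rewrite intr_eq0.
apply/seteqP; split=> // z _; rewrite -[z]reprK -/(cls _).
apply/(cls_closed _ hS) => p Sp.
have V (n1 n2 n3 n4 : nat) : vanishes p (transv (n1%:R * (e 0)%:~R) a1 c1 *
    transv (n2%:R * (e j)%:~R) a2 c2 * transv (n3%:R * (e 0)%:~R) a1 c1 *
    transv (n4%:R * (e j)%:~R) a2 c2)%g.
  rewrite -!(word_val_nseq _ q0) -!(word_val_nseq _ qj) -!word_val_cat.
  move: p Sp; apply/(cls_closed _ hS); apply: sub.
  set u := _ ++ _; exists (\pi_pi1 u) => //; exact: rep_ofE.
pose T0 (n : nat) := transv (n%:R * (e 0)%:~R : R) a1 c1.
pose Tj (n : nat) := transv (n%:R * (e j)%:~R : R) a2 c2.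
have V1 t (n2 n3 n4 : nat) :
    vanishes p (transv t a1 c1 * Tj n2 * T0 n3 * Tj n4)%g.
  apply: (@vanishes_line p _ a1 c1 1%g (Tj n2 * T0 n3 * Tj n4)%g
    (fun t => transv t a1 c1 * Tj n2 * T0 n3 * Tj n4)%g _ (ee 0)).
    by move=> x; rewrite mul1g !mulgA.
  by move=> n; exact: V.
have V2 t t' (n3 n4 : nat) :
    vanishes p (transv t a1 c1 * transv t' a2 c2 * T0 n3 * Tj n4)%g.
  apply: (@vanishes_line p _ a2 c2 (transv t a1 c1) (T0 n3 * Tj n4)%g
    (fun t' => transv t a1 c1 * transv t' a2 c2 * T0 n3 * Tj n4)%g _ (ee j)).
    by move=> x; rewrite !mulgA.
  by move=> n; exact: V1.
have V3 t t' t'' (n4 : nat) :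
    vanishes p (transv t a1 c1 * transv t' a2 c2 * transv t'' a1 c1 * Tj n4)%g.
  apply: (@vanishes_line p _ a1 c1 (transv t a1 c1 * transv t' a2 c2)%g (Tj n4)
    (fun t'' => transv t a1 c1 * transv t' a2 c2 * transv t'' a1 c1 * Tj n4)%g _ (ee
      0)) => //.
  by move=> n; exact: V2.
have [t1 [t2 [t3 [t4 ->]]]] := two_transv_generate (repr z) w0.
apply: (@vanishes_line p _ a2 c2 (transv t1 a1 c1 * transv t2 a2 c2 * transv t3 a1
  c1)%g 1%g
  (fun t4 => transv t1 a1 c1 * transv t2 a2 c2 * transv t3 a1 c1 * transv t4 a2 c2)%g
    _ (ee j)).
  by move=> x; rewrite mulg1.
by move=> n; exact: V3.
Qed.

(** The matrices with eigenvector (a, c) form a Zariski-closed set, given by one linear equation in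
    the entries, which does not see the sign of the lift. *)
Lemma dense_no_common_fixed q : central q -> zariski_dense (range (rep_of q)) ->
  ~ common_fixed q.
Proof.
move=> cq dense [a [c [ac H]]].
pose Z : set (PSL2 R) := [set g | form (repr g) a c = 0].
have ZE A : Z (cls A) <-> form A a c = 0.
  rewrite /Z /=; have /PSL2_eqP[->//|->] := reprK (cls A).
  rewrite /form /= !mxE; split=> h;
    [apply: (eqr_lin (k := -1) h)|apply: (eqr_lin (k := -1) h)]; ring.
pose X i j : mpoly.mpoly (2 * 2) R := mpoly.mpolyX R (mpoly.mnm1 (mxvec_index i j)).
pose p := (a * c) *: X 0 0 + c ^+ 2 *: X 0 1 - a ^+ 2 *: X 1 0 - (a * c) *: X 1 1.
have cZ : zariski_closed Z.
  exists [set p]; apply/seteqP; split=> A /=.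
    move=> /ZE h _ ->; rewrite /p !(mpoly.mevalB, mpoly.mevalD, mpoly.mevalZ)
      !mpoly.mevalXU !mxvecE.
    by rewrite -h /form; ring.
  move=> /(_ p erefl);
    rewrite /p !(mpoly.mevalB, mpoly.mevalD, mpoly.mevalZ) !mpoly.mevalXU !mxvecE => h.
  by apply/ZE; rewrite -h /form; ring.
have : range (rep_of q) `<=` Z.
  move=> _ [g _ <-]; rewrite -[g]reprK rep_ofE //; apply/ZE; apply: form_fixes.
  elim: (repr g) => [|[i b] u IH] /=.
    by rewrite /fixes !scalar_mx2; split; ring.
  by apply: fixesM => //; rewrite /letter /=; case: b => //; exact: fixesV.
move/(dense _ cZ) => ZT.
(* The transvection along the orthogonal vector (c, -a) has [form] value (a^2 + c^2)^2 at (a, c), so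
   the closed set is proper. *)
have /ZE : Z (cls (transv 1 c (- a))) by rewrite ZT.
rewrite form_transv mul1r mulNr opprK => /eqP;
  rewrite sqrf_eq0 -!expr2 paddr_eq0 ?sqr_ge0 //.
by rewrite !sqrf_eq0 => /andP[c0 a0]; rewrite a0 c0 in ac.
Qed.
End zariski.

(** * Lifts to the universal cover *)

Section lifts.
Variable R : realType.
Implicit Types (A B T h : SL2 R) (a c x y t : R) (f L : R -> R).

(** For the unit vector u = [bdry t], [form] and [dotp] are |T u| times the sine and the cosine of
    the angle from u to T u, and [stretch] is |T u|. *)
Definition dotp A x y : R :=
  (val A 0 0 * x + val A 0 1 * y) * x + (val A 1 0 * x + val A 1 1 * y) * y.

Definition stretch T t : R :=
  Num.sqrt (form T (sin t) (cos t) ^+ 2 + dotp T (sin t) (cos t) ^+ 2).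

(* The angle from u = bdry t to T u, as twice the arctangent of the half-angle
   formula sin / (1 + cos). *)
Definition lift T t : R :=
  t + 2 * atan (form T (sin t) (cos t) / (stretch T t + dotp T (sin t) (cos t))).

(** |T u| + <T u, u> could vanish only if T u were a negative multiple of u, but the only eigenvalue
    of T is 1. *)
Lemma stretch_gt0 (e : R) T t : parab e T ->
  0 < stretch T t + dotp T (sin t) (cos t) /\ 0 < stretch T t.
Proof.
move=> [a [c [_ ->]]]; set T0 := transv e a c.
rewrite /stretch; set C := form _ _ _; set D := dotp _ _ _.
have CE : C = e * (a * cos t - c * sin t) ^+ 2 by rewrite /C form_transv.
have DE : D = 1 + e * (a * cos t - c * sin t) * (a * sin t + c * cos t).
  rewrite /D /dotp !sl2E !mx2E.
  by apply: (eqr_lin (k := 1) (cos2Dsin2 t)); ring.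
have S0 : 0 <= C ^+ 2 + D ^+ 2 by rewrite addr_ge0 // sqr_ge0.
have [C0|C0] := eqVneq C 0.
  have D1 : D = 1.
    move: C0 => /eqP; rewrite CE mulf_eq0 sqrf_eq0 => /orP[/eqP e0|/eqP k0].
      by rewrite DE e0 !mul0r addr0.
    by rewrite DE k0 mulr0 mul0r addr0.
  by rewrite C0 D1 expr0n /= expr1n add0r sqrtr1.
have C2 : 0 < C ^+ 2 by rewrite lt_neqAle sqr_ge0 andbT eq_sym sqrf_eq0.
have N0 : 0 < Num.sqrt (C ^+ 2 + D ^+ 2).
  by rewrite sqrtr_gt0 ltr_pwDl // sqr_ge0.
split=> //; have ND := sqr_sqrtr S0; set N := Num.sqrt _ in N0 ND *.
rewrite ltNge; apply/negP => h; nra.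
Qed.

Lemma lift_spec (e : R) T t : parab e T ->
  [/\ val T 0 0 * sin t + val T 0 1 * cos t = stretch T t * sin (lift T t),
      val T 1 0 * sin t + val T 1 1 * cos t = stretch T t * cos (lift T t)
    & 0 < stretch T t].
Proof.
move=> hT; have [nd n0] := stretch_gt0 t hT.
rewrite /lift; set C := form _ _ _; set D := dotp _ _ _ in nd *.
set N := stretch T t in nd n0 *.
have N2 : N ^+ 2 = C ^+ 2 + D ^+ 2 by rewrite sqr_sqrtr // addr_ge0 // sqr_ge0.
set w := C / (N + D); set d := 2 * atan w.
have nd0 := lt0r_neq0 nd; have n00 := lt0r_neq0 n0.
(* The half-angle tangent [w] gives the squared cosine of the half angle; the double-angle formulas
   then give cos d = D / N and sin d = C / N. *)
have w2 : 1 + w ^+ 2 = 2 * N / (N + D).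
  transitivity (((N + D) ^+ 2 + C ^+ 2) / (N + D) ^+ 2); first by rewrite /w; field.
  have -> : C ^+ 2 = N ^+ 2 - D ^+ 2 by rewrite N2; ring.
  by field.
have cosw : cos (atan w) ^+ 2 = (N + D) / (2 * N).
  rewrite cos_atan exprVn sqr_sqrtr; last by rewrite addr_ge0 ?sqr_ge0.
  by rewrite w2; field; rewrite n00 nd0.
have cos0 : cos (atan w) != 0.
  by rewrite lt0r_neq0 // cos_gt0_pihalf // atan_gtNpi2 atan_ltpi2.
have sinw : sin (atan w) = w * cos (atan w).
  by rewrite -{2}(atanK w) /tan divfK.
have dE : d = atan w *+ 2 by rewrite /d mulr_natl.
have cd : N * cos d = D.
  by rewrite dE cos_mulr2n cosw; field.
have sd : N * sin d = C.
  rewrite dE sin_mulr2n sinw -mulr_natl mulrCA.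
  transitivity (2 * N * w * cos (atan w) ^+ 2); first by ring.
  by rewrite cosw /w; field; rewrite n00 nd0.
have CE : C = (val T 0 0 * sin t + val T 0 1 * cos t) * cos t
   - (val T 1 0 * sin t + val T 1 1 * cos t) * sin t by [].
have DE : D = (val T 0 0 * sin t + val T 0 1 * cos t) * sin t
   + (val T 1 0 * sin t + val T 1 1 * cos t) * cos t by [].
have cs := cos2Dsin2 t.
split=> //.
- rewrite sinD mulrDr mulrCA cd [N * (_ * _)]mulrCA sd CE DE.
  apply: (eqr_lin (k := - (val T 0 0 * sin t + val T 0 1 * cos t)) cs); ring.
- rewrite cosD mulrBr mulrCA cd [N * (_ * _)]mulrCA sd CE DE.
  apply: (eqr_lin (k := - (val T 1 0 * sin t + val T 1 1 * cos t)) cs); ring.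
Qed.

Lemma lift_continuous (e : R) T : parab e T -> continuous (lift T).
Proof.
move=> hT.
have cs := @continuous_sin R; have cc := @continuous_cos R.
have lin (p r : R) : continuous (fun t => p * sin t + r * cos t).
  by move=> t; apply: cvgD; apply: cvgM;
    [exact: cvg_cst|exact: cs|exact: cvg_cst|exact: cc].
have cF : continuous (fun t => form T (sin t) (cos t)).
  by move=> t; apply: cvgB; apply: cvgM; [exact: lin|exact: cc|exact: lin|exact: cs].
have cD : continuous (fun t => dotp T (sin t) (cos t)).
  by move=> t; apply: cvgD; apply: cvgM; [exact: lin|exact: cs|exact: lin|exact: cc].
have cN : continuous (stretch T).
  move=> t; apply: (@continuous_comp _ _ _
    (fun t => form T (sin t) (cos t) ^+ 2 + dotp T (sin t) (cos t) ^+ 2) Num.sqrt).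
    by apply: cvgD; apply: cvgM; [exact: cF|exact: cF|exact: cD|exact: cD].
  exact: sqrt_continuous.
move=> t; apply: cvgD; first exact: cvg_id.
apply: cvgM; first exact: cvg_cst.
apply: (@continuous_comp _ _ _
  (fun t => form T (sin t) (cos t) / (stretch T t + dotp T (sin t) (cos t))) atan).
  apply: cvgM; first exact: cF.
  apply: cvgV; first by apply: lt0r_neq0; have [] := stretch_gt0 t hT.
  by apply: cvgD; [exact: cN|exact: cD].
exact: continuous_atan.
Qed.

Lemma atan_ge0 (w : R) : 0 <= w -> 0 <= atan w.
Proof. by move=> h; rewrite -(atan0 R); exact: le_atan. Qed.

(** The arctangent has the sign of [form], which is a square here, and twice an arctangent is less
    than pi. *)
Lemma lift_pos T t : parab 1 T -> t <= lift T t < t + pi.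
Proof.
move=> hT; have [nd _] := stretch_gt0 t hT; have [a [c [_ E]]] := hT.
rewrite /lift; set w := _ / _.
have w0 : 0 <= w.
  by apply: divr_ge0; [rewrite E form_transv mul1r sqr_ge0|exact: ltW].
have := atan_ge0 w0; have := atan_ltpi2 w; set p := pi; lra.
Qed.

Lemma lift_neg T t : parab (-1) T -> t - pi < lift T t <= t.
Proof.
move=> hT; have [nd _] := stretch_gt0 t hT; have [a [c [_ E]]] := hT.
rewrite /lift; set w := _ / _.
have w0 : 0 <= - w.
  by rewrite /w -mulNr; apply: divr_ge0;
    [rewrite E form_transv mulN1r opprK sqr_ge0|exact: ltW].
have := atan_ge0 w0; rewrite atanN; have := atan_gtNpi2 w; set p := pi; lra.
Qed.

Lemma lift_fix (e : R) T t : e != 0 -> parab e T -> lift T t = t <->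
  fixes T (sin t) (cos t).
Proof.
move=> e0 hT; have [nd _] := stretch_gt0 t hT.
split; last first.
  by move=> /form_fixes; rewrite /lift => ->; rewrite mul0r atan0 mulr0 addr0.
rewrite /lift => E; have h : atan (form T (sin t) (cos t) /
    (stretch T t + dotp T (sin t) (cos t))) = 0 by lra.
apply: (fixes_parab e0) => //; apply/eqP.
have : tan (atan (form T (sin t) (cos t) / (stretch T t + dotp T (sin t) (cos t)))) = 0.
  by rewrite h tan0.
by rewrite atanK => /eqP; rewrite mulf_eq0 invr_eq0 (negbTE (lt0r_neq0 nd)) orbF.
Qed.

Lemma lift_has_fix (e : R) T : e != 0 -> parab e T -> exists t, lift T t = t.
Proof.
move=> e0 hT; have [a [c [nz E]]] := hT.
(* The fixed direction is that of the vector (a, c), so tan t = a / c. *)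
have [t k0] : exists t, a * cos t - c * sin t = 0.
  have [->|c0] := eqVneq c 0; first by exists (pi / 2);
    rewrite cos_pihalf mulr0 mul0r subr0.
  exists (atan (a / c)).
  have h : cos (atan (a / c)) != 0.
    by rewrite lt0r_neq0 // cos_gt0_pihalf // atan_gtNpi2 atan_ltpi2.
  have -> : sin (atan (a / c)) = a / c * cos (atan (a / c)).
    by rewrite -{2}(atanK (a / c)) /tan divfK.
  by field.
exists t; apply/(lift_fix _ e0 hT); apply: (fixes_parab e0 hT).
by rewrite E form_transv k0 expr0n /= mulr0.
Qed.

(** If f s < f t, the intermediate value theorem would give a value y of f with 0 < y - f s < pi,
    where sin (y - f s) is positive. *)
Lemma sin0_const f : continuous f -> (forall t, sin (f t) = 0) -> forall s t, f s = f t.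
Proof.
move=> cf h.
have key s t : f s < f t -> False.
  move=> lt.
  pose y := Num.min ((f s + f t) / 2) (f s + pi / 2).
  have p0 := @pi_gt0 R.
  have y1 : f s < y by rewrite /y lt_min; apply/andP; split; lra.
  have y2 : y < f t by rewrite /y gt_min; apply/orP; left; lra.
  have y3 : y - f s < pi by have : y <= f s + pi / 2 by [rewrite /y ge_min lexx
    orbT]; lra.
  have [r rE] : exists r, f r = y.
    have [st|ts] := leP s t.
      have [|r _ <-] := @IVT R f s t y st (continuous_subspaceT cf); last by exists r.
      by rewrite ge_min le_max; apply/andP; split; apply/orP; [left|right]; apply: ltW.
    have [|r _ <-] := @IVT R f t s y (ltW ts) (continuous_subspaceT cf);
      last by exists r.
    by rewrite ge_min le_max; apply/andP; split; apply/orP; [right|left]; apply: ltW.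
  have : 0 < sin (y - f s) by apply: sin_gt0_pi; rewrite y3 andbT subr_gt0.
  by rewrite -rE sinB !h mul0r mulr0 subrr ltxx.
by move=> s t; have [/key|/key|] := ltgtP (f s) (f t).
Qed.

Lemma bdry_collinear (s t l m : R) : m != 0 ->
  l * sin s = m * sin t -> l * cos s = m * cos t -> sin (s - t) = 0.
Proof.
move=> m0 h1 h2; apply/eqP; rewrite sinB; apply/eqP.
have l0 : l != 0.
  apply: contra_neq m0 => l0; have := cos2Dsin2 t.
  rewrite l0 !mul0r in h1 h2; have [/eqP|] := eqVneq m 0; first by move/eqP.
  move=> mm; move/esym/eqP: h1; rewrite mulf_eq0 (negbTE mm) /= => /eqP ->.
  move/esym/eqP: h2; rewrite mulf_eq0 (negbTE mm) /= => /eqP ->.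
  by rewrite !expr0n /= addr0 => /eqP; rewrite eq_sym oner_eq0.
apply: (mulfI l0); rewrite mulr0 mulrBr !mulrA h1 h2; ring.
Qed.

Lemma mul_bdry A t x l : (val A *m bdry t = l *: (bdry x : 'cV[R]_2)) <->
  val A 0 0 * sin t + val A 0 1 * cos t = l * sin x /\
  val A 1 0 * sin t + val A 1 1 * cos t = l * cos x.
Proof.
have E k : (val A *m bdry t) k 0 = val A k 0 * sin t + val A k 1 * cos t.
  by rewrite mxE !big_ord_recl big_ord0 addr0 /bdry !mxE /=;
    congr (_ + val A k _ * _); exact: val_inj.
split.
  move=> h; split.
  - by rewrite -E h !mxE.
  - by rewrite -E h !mxE.
move=> [h1 h2]; apply/matrixP => k j; rewrite ord1 E; move: k; elim/ord2_ind.
- by rewrite h1 !mxE.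
- by rewrite h2 !mxE.
Qed.
End lifts.

(** * Euler class *)

Section euler.
Variable R : realType.
Implicit Types (T : SL2 R) (t x y : R) (f : R -> R).

Lemma repr_cls T : repr (cls T) = T \/ repr (cls T) = SL2_opp T.
Proof. by have /PSL2_eqP := reprK (cls T). Qed.

Lemma cls_liftP T f : is_lift (cls T) f <->
  continuous f /\ forall t, exists l, val T *m bdry t = l *: (bdry (f t) : 'cV[R]_2).
Proof.
split=> -[cf h]; split=> // t; have [l E] := h t; case: (repr_cls T) E => E' E.
- by exists l; rewrite -E'.
- by exists (- l); rewrite scaleNr -E E' /= mulNmx opprK.
- by exists l; rewrite E'.
- by exists (- l); rewrite scaleNr -E E' /= mulNmx.
Qed.

Lemma lift_bdry (e : R) T t : parab e T ->
  val T *m bdry t = stretch T t *: (bdry (lift T t) : 'cV[R]_2).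
Proof. by move=> hT; apply/mul_bdry; have [] := lift_spec t hT. Qed.

Lemma fixed_lift_lift (e : R) T : e != 0 -> parab e T -> fixed_lift (cls T) (lift T).
Proof.
move=> e0 hT; split; last exact: lift_has_fix e0 hT.
apply/cls_liftP; split; first exact: lift_continuous hT.
by move=> t; exists (stretch T t); exact: lift_bdry hT.
Qed.

(** Two lifts differ by a continuous function with values in the multiples of pi, hence by a
    constant. At a fixed point t0 of f the vector [bdry t0] is an eigenvector of T, thus fixed by T,
    and the constant is 0. *)
Lemma fixed_lift_unique (e : R) T f : e != 0 -> parab e T ->
  fixed_lift (cls T) f -> f = lift T.
Proof.
move=> e0 hT [/cls_liftP[cf h] [t0 ft0]].
have cg : continuous (fun t => f t - lift T t).
  by move=> t; apply: cvgB; [exact: cf|exact: (lift_continuous hT)].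
have g0 t : sin (f t - lift T t) = 0.
  have [l E] := h t; have [h1 h2] := (mul_bdry _ _ _ _).1 E;
    have [s1 s2 s0] := lift_spec t hT.
  apply: (@bdry_collinear _ _ _ l (stretch T t)); first exact: lt0r_neq0.
  - by rewrite -h1 -s1.
  - by rewrite -h2 -s2.
have l0 : lift T t0 = t0.
  apply/(lift_fix _ e0 hT); apply: (fixes_parab e0 hT).
  have [l E] := h t0; have [h1 h2] := (mul_bdry _ _ _ _).1 E; rewrite ft0 in h1 h2.
  by rewrite /form h1 h2; ring.
apply/funext => t; apply/eqP; rewrite -subr_eq0.
by rewrite (sin0_const cg g0 t t0) ft0 l0 subrr.
Qed.

(** The displacement is at most pi in absolute value, so the intermediate value theorem applies on
    [y - pi, y + pi]. *)
Lemma lift_surj (e : int) T y : e = 1 \/ e = -1 -> parab e%:~R T ->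
  exists t, lift T t = y.
Proof.
move=> he hT.
have b t : t - pi <= lift T t <= t + pi.
  have p0 := @pi_gt0 R.
  case: he hT => -> hT; rewrite ?mulrN1z in hT.
  - by have /andP[h1 h2] := lift_pos t hT; apply/andP; split; lra.
  - by have /andP[h1 h2] := lift_neg t hT; apply/andP; split; lra.
have p0 := @pi_gt0 R.
have [|||t _ <-] := @IVT R (lift T) (y - pi) (y + pi) y.
- by lra.
- exact/continuous_subspaceT/(lift_continuous hT).
- rewrite ge_min le_max; apply/andP; split; apply/orP; [left|right].
  + by have /andP[] := b (y - pi); lra.
  + by have /andP[] := b (y + pi); lra.
- by exists t.
Qed.

Variables (d : R) (e : 'I_4 -> int) (q : 'I_4 -> SL2 R).
Hypothesis he : forall i, e i = 1 \/ e i = -1.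
Hypothesis Gq : good d e q.

Let er i : (e i)%:~R != 0 :> R.
Proof. by case: (he i) => ->; rewrite ?mulrN1z ?oppr_eq0 oner_eq0. Qed.

Let P i : parab (e i)%:~R (q i). Proof. by have [] := Gq. Qed.

Definition total_lift t : R :=
  lift (q 0) (lift (q 1) (lift (q 2) (lift (q 3) t))).

(** The factor n is a product of norms; its positivity is what lets the sign of d determine the
    parity of the shift. *)
Lemma total_lift_spec t : exists2 n, 0 < n &
  d * sin t = n * sin (total_lift t) /\ d * cos t = n * cos (total_lift t).
Proof.
have [_ m _] := Gq.
have s i x : 0 < stretch (q i) x by have [] := lift_spec x (P i).
pose n := stretch (q 3) t * stretch (q 2) (lift (q 3) t) *
   stretch (q 1) (lift (q 2) (lift (q 3) t)) *
   stretch (q 0) (lift (q 1) (lift (q 2) (lift (q 3) t))).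
exists n; first by rewrite !mulr_gt0.
have E : val (q 0%R * q 1%R * q 2%R * q 3%R)%g *m bdry t =
    (val (q 0) *m (val (q 1) *m (val (q 2) *m (val (q 3) *m bdry t)))).
  by rewrite /= !mulmxA.
have {}E : val (q 0%R * q 1%R * q 2%R * q 3%R)%g *m bdry t = n *: (bdry (total_lift
  t) : 'cV[R]_2).
  rewrite E (lift_bdry _ (P 3)) -scalemxAr (lift_bdry _ (P 2)) -!scalemxAr.
  by rewrite (lift_bdry _ (P 1)) -!scalemxAr (lift_bdry _ (P 0)) !scalerA.
have := (mul_bdry _ _ _ _).1 E; rewrite m !scalar_mx2 !mul0r addr0 add0r => -[h1 h2].
by split.
Qed.

Lemma d_neq0 : d != 0.
Proof.
have [_ m _] := Gq; have := SL2_det2 (q 0%R * q 1%R * q 2%R * q 3%R)%g.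
rewrite m !scalar_mx2 mulr0 subr0 => h.
by apply/eqP => d0; move: h; rewrite d0 mulr0 => /eqP; rewrite eq_sym oner_eq0.
Qed.

Lemma total_lift_const : exists h, sin h = 0 /\ forall t, total_lift t = t + h.
Proof.
have c i := @lift_continuous R _ _ (P i).
have ct : continuous total_lift.
  move=> t; apply: (@continuous_comp _ _ _ (fun t =>
    lift (q 1) (lift (q 2) (lift (q 3) t))) (lift (q 0))); last exact: c.
  apply: (@continuous_comp _ _ _ (fun t => lift (q 2) (lift (q 3) t)) (lift (q 1)));
    last exact: c.
  by apply: (@continuous_comp _ _ _ (lift (q 3)) (lift (q 2))); exact: c.
have cg : continuous (fun t => total_lift t - t).
  by move=> t; apply: cvgB; [exact: ct|exact: cvg_id].
have g0 t : sin (total_lift t - t) = 0.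
  have [n n0 [h1 h2]] := total_lift_spec t.
  exact: (bdry_collinear d_neq0 (esym h1) (esym h2)).
exists (total_lift 0 - 0); split=> // t.
by rewrite -(sin0_const cg g0 t 0); ring.
Qed.

(** The orbit is chosen to meet a fixed point of the j-th lift at the j-th place. If all
    displacements were 0, the starting point would give a common fixed vector. *)
Lemma displacements h (j : 'I_4) : (forall t, total_lift t = t + h) ->
  exists r : 'I_4 -> R,
    [/\ forall i, e i = 1 -> 0 <= r i < pi, forall i, e i = -1 -> - pi < r i <= 0,
        r j = 0, h = r 0 + r 1 + r 2 + r 3 & ~ (forall i, r i = 0)].
Proof.
move=> H.
have S i y : exists t, lift (q i) t = y by exact: lift_surj (he i) (P i).
have [x fx] := lift_has_fix (er j) (P j).
(* [p i] is the point to which the i-th lift is applied, [lift (q 3)] acting first; the points that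
   precede [p j] are preimages found by [S]. *)
have [p [p0 p1 p2 pj]] : exists p : 'I_4 -> R,
    [/\ p 0 = lift (q 1) (p 1), p 1 = lift (q 2) (p 2), p 2 = lift (q 3) (p 3) & p j
      = x].
  move: j {fx}; elim/ord4_ind.
  - have [x1 <-] := S 1 x; have [x2 <-] := S 2 x1; have [x3 <-] := S 3 x2.
    by exists (q4 (lift (q 1) (lift (q 2) (lift (q 3) x3))) (lift (q 2) (lift (q 3)
      x3)) (lift (q 3) x3) x3).
  - have [x2 <-] := S 2 x; have [x3 <-] := S 3 x2.
    by exists (q4 (lift (q 1) (lift (q 2) (lift (q 3) x3))) (lift (q 2) (lift (q 3)
      x3)) (lift (q 3) x3) x3).
  - have [x3 <-] := S 3 x.
    by exists (q4 (lift (q 1) (lift (q 2) (lift (q 3) x3))) (lift (q 2) (lift (q 3)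
      x3)) (lift (q 3) x3) x3).
  - by exists (q4 (lift (q 1) (lift (q 2) (lift (q 3) x))) (lift (q 2) (lift (q 3)
    x)) (lift (q 3) x) x).
exists (fun i => lift (q i) (p i) - p i); split.
- move=> i ei; have hT := P i; rewrite ei mulr1z in hT.
  by have /andP[h1 h2] := lift_pos (p i) hT; apply/andP; split; lra.
- move=> i ei; have hT := P i; rewrite ei mulrN1z in hT.
  by have /andP[h1 h2] := lift_neg (p i) hT; apply/andP; split; lra.
- by rewrite pj fx subrr.
- have := H (p 3); rewrite /total_lift -p2 -p1 -p0; lra.
- move=> z; have [_ _ nf] := Gq; apply: nf.
  have z0 i : lift (q i) (p i) = p i by apply/eqP; rewrite -subr_eq0 z.
  have e2 : p 2 = p 3 by rewrite p2 z0.
  have e1 : p 1 = p 3 by rewrite p1 z0.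
  have e0 : p 0 = p 3 by rewrite p0 z0.
  exists (sin (p 3)), (cos (p 3)); split.
    rewrite -negb_and; apply/negP => /andP[/eqP s0 /eqP c0].
    by have := cos2Dsin2 (p 3); rewrite s0 c0 !expr0n /= addr0 => /eqP;
      rewrite eq_sym oner_eq0.
  have F i : p i = p 3 -> fixes (q i) (sin (p 3)) (cos (p 3)).
    by move=> E; apply/(lift_fix _ (er i) (P i)); rewrite -E.
  by elim/ord4_ind; exact: F.
Qed.

(** Two signs of each kind correspond to 0, at most one -1 to values at least 2, and at most one 1
    to values at most -2. *)
Definition sign_sum : int := e 0 + e 1 + e 2 + e 3.

Lemma sign_sum_cases : [\/ sign_sum <= -2, sign_sum = 0 | 2 <= sign_sum].
Proof.
rewrite /sign_sum; case: (he 0) => ->; case: (he 1) => ->; case: (he 2) => ->;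
  case: (he 3) => ->; (by constructor 1) || (by constructor 2) || (by constructor 3).
Qed.

Let bounds (r : 'I_4 -> R) : (forall i, e i = 1 -> 0 <= r i < pi) ->
  (forall i, e i = -1 -> - pi < r i <= 0) ->
  forall i, (e i = 1 /\ 0 <= r i /\ r i < pi) \/ (e i = -1 /\ - pi < r i /\ r i <= 0).
Proof.
move=> rp rn i; case: (he i) => E; [left|right]; split=> //; apply/andP.
- exact: rp.
- exact: rn.
Qed.

(** At most two signs are positive, and one of them can be given displacement 0; the other
    contributes less than pi and the rest nothing positive. *)
Lemma shift_lt_pi h : (forall t, total_lift t = t + h) -> sign_sum <= 0 -> h < pi.
Proof.
move=> H; have p0 := @pi_gt0 R.
have Z j := displacements j H.
have [j hj] : exists j, e j = 1 \/ forall i, e i = -1.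
  case: (he 0) => E0; first by exists 0; left.
  case: (he 1) => E1; first by exists 1; left.
  case: (he 2) => E2; first by exists 2; left.
  case: (he 3) => E3; first by exists 3; left.
  by exists 0; right; elim/ord4_ind.
have [r [rp rn rj -> _]] := Z j; have b := bounds rp rn; rewrite /sign_sum.
case: hj => [ej|en]; last first.
  by rewrite !en => _; have := rn 0 (en 0); have := rn 1 (en 1);
    have := rn 2 (en 2); have := rn 3 (en 3); lra.
move: j ej rj; elim/ord4_ind => -> ->.
- case: (b 1) => -[-> [? ?]]; case: (b 2) => -[-> [? ?]];
  case: (b 3) => -[-> [? ?]] //; lra.
- case: (b 0) => -[-> [? ?]]; case: (b 2) => -[-> [? ?]];
  case: (b 3) => -[-> [? ?]] //; lra.
- case: (b 0) => -[-> [? ?]]; case: (b 1) => -[-> [? ?]];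
  case: (b 3) => -[-> [? ?]] //; lra.
- case: (b 0) => -[-> [? ?]]; case: (b 1) => -[-> [? ?]];
  case: (b 2) => -[-> [? ?]] //; lra.
Qed.

(** The argument of [shift_lt_pi] with the signs exchanged. *)
Lemma shift_gtN_pi h : (forall t, total_lift t = t + h) -> 0 <= sign_sum -> - pi < h.
Proof.
move=> H; have p0 := @pi_gt0 R.
have Z j := displacements j H.
have [j hj] : exists j, e j = -1 \/ forall i, e i = 1.
  case: (he 0) => E0; last by exists 0; left.
  case: (he 1) => E1; last by exists 1; left.
  case: (he 2) => E2; last by exists 2; left.
  case: (he 3) => E3; last by exists 3; left.
  by exists 0; right; elim/ord4_ind.
have [r [rp rn rj -> _]] := Z j; have b := bounds rp rn; rewrite /sign_sum.
case: hj => [ej|en]; last first.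
  by rewrite !en => _; have := rp 0 (en 0); have := rp 1 (en 1);
    have := rp 2 (en 2); have := rp 3 (en 3); lra.
move: j ej rj; elim/ord4_ind => -> ->.
- case: (b 1) => -[-> [? ?]]; case: (b 2) => -[-> [? ?]];
  case: (b 3) => -[-> [? ?]] //; lra.
- case: (b 0) => -[-> [? ?]]; case: (b 2) => -[-> [? ?]];
  case: (b 3) => -[-> [? ?]] //; lra.
- case: (b 0) => -[-> [? ?]]; case: (b 1) => -[-> [? ?]];
  case: (b 3) => -[-> [? ?]] //; lra.
- case: (b 0) => -[-> [? ?]]; case: (b 1) => -[-> [? ?]];
  case: (b 2) => -[-> [? ?]] //; lra.
Qed.

(** At most one sign is -1; giving that one displacement 0 leaves three displacements in [0, pi),
    not all 0. *)
Lemma shift_pos h : (forall t, total_lift t = t + h) -> 2 <= sign_sum ->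
  0 < h < 3 * pi.
Proof.
move=> H; have p0 := @pi_gt0 R.
have Z j := displacements j H.
move=> S; have [j hj] : exists j, forall i, i != j -> e i = 1.
  move: S; rewrite /sign_sum; case: (he 0) => E0; case: (he 1) => E1;
    case: (he 2) => E2;
    case: (he 3) => E3; rewrite E0 E1 E2 E3 // => _.
  + by exists 0; elim/ord4_ind.
  + by exists 3; elim/ord4_ind.
  + by exists 2; elim/ord4_ind.
  + by exists 1; elim/ord4_ind.
  + by exists 0; elim/ord4_ind.
have [r [rp rn rj -> nz]] := Z j.
have r0 i : 0 <= r i.
  by have [->|/hj/rp/andP[]] := eqVneq i j; rewrite ?rj.
have rpi i : r i < pi.
  by have [->|/hj/rp/andP[]] := eqVneq i j; rewrite ?rj.
have R0 := r0 0; have R1 := r0 1; have R2 := r0 2; have R3 := r0 3.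
have Q0 := rpi 0; have Q1 := rpi 1; have Q2 := rpi 2; have Q3 := rpi 3.
apply/andP; split.
  rewrite lt_neqAle; apply/andP; split; last by lra.
  by apply/eqP => s; apply: nz; elim/ord4_ind; lra.
by move: j rj {hj}; elim/ord4_ind => ->; lra.
Qed.

Lemma shift_neg h : (forall t, total_lift t = t + h) -> sign_sum <= -2 ->
  - (3 * pi) < h < 0.
Proof.
move=> H; have p0 := @pi_gt0 R.
have Z j := displacements j H.
move=> S; have [j hj] : exists j, forall i, i != j -> e i = -1.
  move: S; rewrite /sign_sum; case: (he 0) => E0; case: (he 1) => E1;
    case: (he 2) => E2;
    case: (he 3) => E3; rewrite E0 E1 E2 E3 // => _.
  + by exists 0; elim/ord4_ind.
  + by exists 1; elim/ord4_ind.
  + by exists 2; elim/ord4_ind.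
  + by exists 3; elim/ord4_ind.
  + by exists 0; elim/ord4_ind.
have [r [rp rn rj -> nz]] := Z j.
have r0 i : r i <= 0.
  by have [->|/hj/rn/andP[]] := eqVneq i j; rewrite ?rj.
have rpi i : - pi < r i.
  by have [->|/hj/rn/andP[]] := eqVneq i j; rewrite ?rj ?oppr_lt0.
have R0 := r0 0; have R1 := r0 1; have R2 := r0 2; have R3 := r0 3.
have Q0 := rpi 0; have Q1 := rpi 1; have Q2 := rpi 2; have Q3 := rpi 3.
apply/andP; split; last first.
  rewrite lt_neqAle; apply/andP; split; last by lra.
  by apply/eqP => s; apply: nz; elim/ord4_ind; lra.
by move: j rj {hj}; elim/ord4_ind => ->; lra.
Qed.

Lemma shift_sign_sum (k : int) : k = 0 \/ k = 1 \/ k = -1 ->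
  (forall t, total_lift t = t + k%:~R * pi) ->
  [/\ k = 0 -> sign_sum = 0, k = 1 -> 2 <= sign_sum & k = -1 -> sign_sum <= -2].
Proof.
move=> hk H; have p0 := @pi_gt0 R; split=> kE; rewrite kE in H.
- have := shift_pos H; have := shift_neg H; rewrite mul0r.
  case: sign_sum_cases => [S|//|S].
  + by move=> /(_ S); rewrite ltxx andbF.
  + by move=> _ /(_ S); rewrite ltxx.
- rewrite mul1r in H; rewrite leNgt; apply/negP => S.
  have S0 : sign_sum <= 0.
    by case: sign_sum_cases => [h|->//|h]; [exact: le_trans h _|rewrite ltNge h in S].
  by have := shift_lt_pi H S0; rewrite ltxx.
- rewrite mulN1r in H; rewrite leNgt; apply/negP => S.
  have S0 : 0 <= sign_sum.
    by case: sign_sum_cases => [h|->//|h]; [rewrite ltNge h in S|exact: le_trans h].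
  by have := shift_gtN_pi H S0; rewrite ltxx.
Qed.

(** The second coordinate of [total_lift_spec] at t = 0 reads d = n cos (k pi) with n > 0. *)
Lemma d_of_shift (k : int) (hd : d = 1 \/ d = -1) : k = 0 \/ k = 1 \/ k = -1 ->
  (forall t, total_lift t = t + k%:~R * pi) -> d = if k == 0 then 1 else -1.
Proof.
move=> hk H; have [n n0 [_]] := total_lift_spec 0; rewrite H cos0 mulr1 add0r.
case: hk => [->|[->|->]] /=.
- rewrite mul0r cos0 mulr1 => dn; case: hd => // dE; move: n0; rewrite -dn dE; lra.
- rewrite mul1r cospi mulrN1 => dn; case: hd => // dE; move: n0;
  rewrite -[n]opprK -dn dE; lra.
- rewrite mulN1r cosN cospi mulrN1 => dn; case: hd => // dE; move: n0;
  rewrite -[n]opprK -dn dE; lra.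
Qed.

Lemma sin_eq0_pos x : sin x = 0 -> 0 < x < 3 * pi -> x = pi \/ x = 2 * pi.
Proof.
move=> s0 /andP[x0 x3]; have p0 := @pi_gt0 R.
have sp : sin (x - pi) = 0 by rewrite sinB s0 sinpi mul0r mulr0 subrr.
have s2 : sin (x - pi - pi) = 0 by rewrite sinB sp sinpi mul0r mulr0 subrr.
have no y : sin y = 0 -> 0 < y -> y < pi -> False.
  by move=> sy y0 yp; have := @sin_gt0_pi R y; rewrite y0 yp sy ltxx => /(_ isT).
case: (ltgtP x pi) => [xp|xp|->]; [by case: (no x)| |by left].
case: (ltgtP x (2 * pi)) => [x2|x2|->]; last by right.
- by case: (no (x - pi)) => //; lra.
- by case: (no (x - pi - pi)) => //; lra.
Qed.

(** The shift is a multiple of pi. For sum 0 it lies in (-pi, pi); otherwise its absolute value is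
    pi or 2 pi, and d = -1 rules out 2 pi. *)
Lemma shift_of_signs (k : int) :
  [\/ k = 0 /\ sign_sum = 0, [/\ k = 1, d = -1 & 2 <= sign_sum] |
      [/\ k = -1, d = -1 & sign_sum <= -2]] ->
  forall t, total_lift t = t + k%:~R * pi.
Proof.
have p0 := @pi_gt0 R; have [h [s0 H]] := total_lift_const.
have [n n0 [_ c0]] := total_lift_spec 0; rewrite H cos0 mulr1 add0r in c0.
case=> [[-> S]|[-> dE S]|[-> dE S]] t; rewrite H; congr (_ + _).
- rewrite mul0r.
  have := shift_lt_pi H; have := shift_gtN_pi H; rewrite S => /(_ isT) h1 /(_ isT) h2.
  have no y : sin y = 0 -> 0 < y -> y < pi -> False.
    by move=> sy y0 yp; have := @sin_gt0_pi R y; rewrite y0 yp sy ltxx => /(_ isT).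
  case: (ltgtP h 0) => // hh; last by case: (no h).
  by case: (no (- h)); rewrite ?sinN ?s0 ?oppr0 //; lra.
- rewrite mul1r; case: (sin_eq0_pos s0 (shift_pos H S)) => // hE.
  by move: c0; rewrite hE dE mulr_natl cos2pi mulr1; lra.
- have hb : 0 < - h < 3 * pi by have /andP[h1 h2] := shift_neg H S; apply/andP;
  split; lra.
  have sN : sin (- h) = 0 by rewrite sinN s0 oppr0.
  rewrite mulN1r; case: (sin_eq0_pos sN hb) => hE; first by rewrite -hE opprK.
  by move: c0; rewrite -cosN hE dE mulr_natl cos2pi mulr1; lra.
Qed.
End euler.

(** * The moduli spaces *)

Section correspondence.
Variable R : realType.
Implicit Types (T A B : SL2 R) (q : 'I_4 -> SL2 R) (a c : R).

Lemma transv_neq1 (m a c : R) : m != 0 -> (a != 0) || (c != 0) -> transv m a c <> 1%g.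
Proof.
move=> m0 nz E; apply: (@not_parab0 R m m0); rewrite -(transv0 (R := R) a c) in E.
exists a, c; split=> //; rewrite E.
by apply: SL2_eqP; apply: mx2P; rewrite !sl2E !mx2E; ring.
Qed.

Lemma cls_inj_tr A B : \tr (val A) = 2 -> \tr (val B) = 2 -> cls A = cls B -> A = B.
Proof.
move=> hA hB /PSL2_eqP[//|E]; exfalso; move: hA; rewrite E /= raddfN /= hB; lra.
Qed.

Lemma parabolic_transv (m a c : R) : m != 0 -> (a != 0) || (c != 0) ->
  parabolic (cls (transv m a c)).
Proof.
move=> m0 nz; split.
  apply/eqP => E; apply: (transv_neq1 m0 nz); apply: cls_inj_tr => //;
    first exact: tr_transv.
  by rewrite trmx2 !scalar_mx2.
case: (repr_cls (transv m a c)) => ->; rewrite ?tr_transv; first by ring.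
by rewrite /= raddfN /= tr_transv; ring.
Qed.

(** Conjugacy in PSL2 lifts to the matrices of trace 2, and the upper right entry of a transvection
    is e times a square. *)
Lemma positive_parabolicP (e : int) T : e = 1 \/ e = -1 -> parab e%:~R T ->
  positive_parabolic (cls T) <-> e = 1.
Proof.
move=> he [a [c [nz ->]]]; split.
  move=> [h [B [E B10 tB B01]]].
  have {}E : (repr h * transv e%:~R a c * (repr h)^-1)%g = B.
    apply: cls_inj_tr => //; first by rewrite transvJ tr_transv.
    by rewrite -[RHS]E !pi_mul pi_inv /cls reprK.
  move: B01; rewrite -E transvJ sl2E !mx2E.
  by case: he => -> //; rewrite mulrN1z mulN1r oppr_gt0 ltNge sqr_ge0.
move=> ->; rewrite mulr1z.
have n0 : 0 < a ^+ 2 + c ^+ 2.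
  rewrite lt_neqAle addr_ge0 ?sqr_ge0 // andbT eq_sym paddr_eq0 ?sqr_ge0 //.
  by rewrite !sqrf_eq0 negb_and.
have n1 := lt0r_neq0 n0.
(* The conjugating matrix takes (a, c) to (1, 0). *)
have hdet : a / (a ^+ 2 + c ^+ 2) * a - c / (a ^+ 2 + c ^+ 2) * (- c) = 1 by field.
exists (cls (sl2 hdet)), (transv 1 1 0); split.
- rewrite -pi_inv -!pi_mul transvJ; congr (cls (transv _ _ _)); rewrite !sl2E !mx2E;
  last by ring.
  by field.
- by rewrite sl2E mx2E expr0n /= mulr0 oppr0.
- exact: tr_transv.
- by rewrite sl2E mx2E expr1n mulr1.
Qed.

Lemma parab_of_trace T : \tr (val T) = 2 -> T <> 1%g ->
  exists e : int, (e = 1 \/ e = -1) /\ parab e%:~R T.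
Proof.
move=> tr T1.
have [h|h|h] := ltgtP (val T 0 1) (val T 1 0).
- exists (-1); split; first by right.
  by apply: parab_off => //; [right|rewrite mulrN1z; lra].
- exists 1; split; first by left.
  by apply: parab_off => //; [left|rewrite mulr1z; lra].
(* A symmetric matrix with trace 2 and determinant 1 is the identity. *)
- exfalso; apply: T1; have := SL2_det2 T; move: tr; rewrite trmx2 h.
  set n := val T 1 0 in h *; set m := val T 0 0; set k := val T 1 1 => tr hd.
  have sq : n ^+ 2 + (k - 1) ^+ 2 = 0.
    have mE : m = 2 - k by rewrite -tr; ring.
    by rewrite mE in hd; apply: (eqr_lin (k := -1) hd); ring.
  move/eqP: sq; rewrite paddr_eq0 ?sqr_ge0 // !sqrf_eq0 subr_eq0 =>
    /andP[/eqP n0 /eqP k1].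
  apply: SL2_eqP; apply: mx2P; rewrite !scalar_mx2 ?h -/n -/k //.
  by rewrite -/m; move: tr; rewrite k1; lra.
Qed.

Definition letter_weight (i : 'I_4) (x : 'I_4 * bool) : int :=
  (if x.2 then -1 else 1) * (if x.1 == i then 3 else -1).

Definition word_weight (i : 'I_4) (u : word) : int :=
  foldr (fun x n => letter_weight i x + n) 0 u.

Lemma word_weight_cat i u v : word_weight i (u ++ v) = word_weight i u + word_weight
  i v.
Proof. by elim: u => [|x u IH] /=; rewrite ?add0r // IH addrA. Qed.

(* Giving the i-th generator weight 3 and the three others weight -1 kills the
   relator. *)
Lemma word_weight_eq i u v : word_eq u v -> word_weight i u = word_weight i v.
Proof.
elim=> //.
- by move=> a b c _ -> _ ->.
- by move=> a a' b b' _ h1 _ h2; rewrite !word_weight_cat h1 h2.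
- move=> j b; rewrite /= addr0 /letter_weight /=; case: b => /=; ring.
- by rewrite enum_ord4; move: i; elim/ord4_ind.
Qed.

(** [type_preserving] constrains only nontrivial elements. The loop has weight 3 and the empty word
    weight 0. *)
Lemma puncture_loop_neq1 i : puncture_loop i != 1%g.
Proof.
apply/eqP => /pi1_eqP /(word_weight_eq i).
by rewrite /= /letter_weight /= eqxx.
Qed.

Lemma peripheral_loop i : peripheral (puncture_loop i).
Proof. by exists i, 1%N, 1%g; left; rewrite invg1 mulg1 mul1g. Qed.

Lemma repX (rho : rep_space R) g n : representation rho ->
  rho (g ^+ n)%g = (rho g ^+ n)%g.
Proof. by move=> hr; elim: n => [|n IH]; rewrite ?expg0 ?rep1 // !expgS hr IH. Qed.

Lemma cls_transvX (e a c : R) n : (cls (transv e a c) ^+ n)%g = cls (transv (n%:R *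
  e) a c).
Proof.
elim: n => [|n IH]; first by rewrite expg0 mul0r transv0.
by rewrite expgS IH -pi_mul transvD; congr (cls (transv _ _ _)); rewrite -natr1; ring.
Qed.

Lemma transvV (e a c : R) : ((transv e a c)^-1 = transv (- e) a c)%g.
Proof.
apply: (mulgI (transv e a c)); rewrite mulgV transvD subrr transv0 //.
Qed.

(** A nontrivial peripheral element is conjugate to a nonzero power of some c_i, and such a power
    multiplies the coefficient of the transvection by a nonzero integer. *)
Lemma rep_of_type_preserving d e q : d = 1 \/ d = -1 -> (forall i, e i != 0) ->
  good d e q -> type_preserving (rep_of q).
Proof.
move=> hd e0 G g [i [n [h hg]]] g1.
have [P m _] := G; have cq : central q := cls_scalar hd m.
have hr := rep_of_rep cq; have [a [c [nz qi]]] := P i.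
have n0 : n != 0%N.
  by apply: contra_neq g1 => n0; case: hg => ->; rewrite n0 expg0 ?invg1 mulg1 mulgV.
have ei : (e i)%:~R != 0 :> R by rewrite intr_eq0.
have [k k0 E] : exists2 k : R, k != 0 &
    rep_of q g = (rep_of q h * cls (transv k a c) * (rep_of q h)^-1)%g.
  have L : (rep_of q (puncture_loop i) ^+ n)%g = cls (transv (n%:R * (e i)%:~R) a c).
    by rewrite rep_of_loop // qi cls_transvX.
  case: hg => ->; rewrite !hr !repV // repX // L.
  - by exists (n%:R * (e i)%:~R) => //; rewrite mulf_neq0 // pnatr_eq0.
  - exists (- (n%:R * (e i)%:~R)); first by rewrite oppr_eq0 mulf_neq0 // pnatr_eq0.
    by rewrite -pi_inv transvV.
rewrite E -[rep_of q h]reprK -/(cls _) -pi_inv -!pi_mul transvJ.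
by apply: parabolic_transv => //; exact: SL2_neq0.
Qed.

(** This is (-1)^k for the values 0, 1, -1 of k. *)
Definition product_sign (k : int) : R := if k == 0 then 1 else -1.

Definition sign_class (k : int) (s : 'I_4 -> int) : Prop :=
  [/\ k = 0 -> sign_sum s = 0, k = 1 -> 2 <= sign_sum s & k = -1 -> sign_sum s <= -2].

Variables (k : int) (s : 'I_4 -> int).
Hypothesis hk : k = 0 \/ k = 1 \/ k = -1.
Hypothesis hs : forall i, s i = 1 \/ s i = -1.

Let hd : product_sign k = 1 \/ product_sign k = -1.
Proof. by rewrite /product_sign; case: eqP; [left|right]. Qed.

Let s0 i : s i != 0. Proof. by case: (hs i) => ->. Qed.

Let s0R i : (s i)%:~R != 0 :> R. Proof. by rewrite intr_eq0. Qed.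

Lemma good_rep q : sign_class k s -> good (product_sign k) s q ->
  type_preserving_reps k s (rep_of q).
Proof.
move=> [S0 S1 SN] G; have [P m _] := G; have cq : central q := cls_scalar hd m.
split.
- exact: rep_of_rep.
- exact: rep_of_type_preserving hd s0 G.
- exact: rep_of_dense hd s0 G.
- exists (fun i => lift (q i)); split.
    by move=> i; rewrite rep_of_loop //; exact: fixed_lift_lift (s0R i) (P i).
  apply: (shift_of_signs hs G); case: hk => [k0|[k1|kN]].
  + by constructor 1; split=> //; exact: S0.
  + by constructor 2; split=> //; [rewrite /product_sign k1|exact: S1].
  + by constructor 3; split=> //; [rewrite /product_sign kN|exact: SN].
- move=> i; rewrite /puncture_sign rep_of_loop //.
  have pp := positive_parabolicP (hs i) (P i).
  case: asboolP => [/pp ->//|np]; case: (hs i) => // si; exfalso; exact/np/pp.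
Qed.

Lemma rep_good (rho : rep_space R) : type_preserving_reps k s rho ->
  (exists q, good (product_sign k) s q /\ rho = rep_of q) /\ sign_class k s.
Proof.
move=> [hr tp ne [f [fl fE]] ps].
have pick i : exists A : SL2 R, cls A = rho (puncture_loop i) /\ parab (s i)%:~R A.
  have [r1 rt] := tp _ (peripheral_loop i) (puncture_loop_neq1 i).
  (* Of the two lifts A and -A of a parabolic element, one has trace 2. *)
  have [A [Ac At]] : exists A : SL2 R, cls A = rho (puncture_loop i) /\ \tr (val A) = 2.
    have : (\tr (val (repr (rho (puncture_loop i))))) ^+ 2 = 2 ^+ 2 by rewrite rt; ring.
    move/eqP; rewrite eqf_sqr => /orP[/eqP t2|/eqP t2].
      by exists (repr (rho (puncture_loop i))); split=> //; rewrite /cls reprK.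
    exists (SL2_opp (repr (rho (puncture_loop i)))); split.
      by rewrite -[RHS]reprK; apply/PSL2_eqP; right.
    by rewrite /= raddfN /= t2 opprK.
  have A1 : A <> 1%g by move=> A1; move: r1; rewrite -Ac A1 eqxx.
  have [e [he pe]] := parab_of_trace At A1.
  exists A; split=> //; have := ps i; rewrite /puncture_sign -Ac.
  have pp := positive_parabolicP he pe.
  case: asboolP => [/pp e1 <-|np <-]; first by rewrite -e1.
  case: he pe => [e1|->//] _; exfalso; exact/np/pp.
have [q hq] := choice pick.
have [cq rE] := rep_ofP hr (fun i => (hq i).1).
have nf : ~ common_fixed q.
  by apply: dense_no_common_fixed => //; rewrite -rE.
have [d hd' mq] : exists2 d : R, d = 1 \/ d = -1 & val (q 0%R * q 1%R * q 2%R * q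
  3%R)%g = d%:M.
  move/PSL2_eqP: cq => [->|->]; first by exists 1; [left|].
  by exists (-1); [right|rewrite /= raddfN].
have G : good d s q by split=> // i; exact: (hq i).2.
have fL i : f i = lift (q i).
  by apply: (fixed_lift_unique (s0R i) (hq i).2); rewrite (hq i).1; exact: fl.
have tl t : total_lift q t = t + k%:~R * pi by rewrite -fE !fL.
split; last first.
  by have := shift_sign_sum hs G hk tl.
by exists q; split=> //; rewrite /product_sign -(d_of_shift G hd' hk tl).
Qed.

Lemma moduli_nonempty_signs : [set: moduli R k s] !=set0 -> sign_class k s.
Proof.
move=> [m _]; case: (repr m) => rho hrho.
by have [] := rep_good (set_mem hrho).
Qed.

Lemma moduli_conn : sign_class k s -> conn (product_sign k) s ->
  [set: moduli R k s] !=set0 /\ connected [set: moduli R k s].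
Proof.
move=> S C; apply: (moduli_of_conn hd _ _ C) => [q|rho /rep_good[]//].
exact: good_rep.
Qed.
End correspondence.

(** * Reduction to the basic sign patterns, and the theorem *)

Lemma conn_rot4 (R : realType) (d : R) a b c f : conn d (q4 a b c f) ->
  conn d (q4 b c f a).
Proof. by move/conn_rot; congr conn; apply/funext; elim/ord4_ind. Qed.

Lemma conn_swap4 (R : realType) (d : R) a b c f : conn d (q4 a b c f) ->
  conn d (q4 b a c f).
Proof. exact: conn_swap. Qed.

Lemma conn_mirror4 (R : realType) (d : R) a b c f :
  conn d (q4 a b c f) -> conn d (q4 (- a) (- b) (- c) (- f)).
Proof. by move/conn_mirror; congr conn; apply/funext; elim/ord4_ind. Qed.

Lemma conn_signs (R : realType) (k : int) (s : 'I_4 -> int) :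
  k = 0 \/ k = 1 \/ k = -1 -> (forall i, s i = 1 \/ s i = -1) ->
  sign_class k s -> conn (product_sign R k) s.
Proof.
(* The Z's are the six patterns with sum 0, the U's those with at most one -1, and the V's those
   with at most one 1. *)
have Z1 := conn_pmpm R; have Z2 := conn_rot4 Z1.
have Z3 := conn_swap4 Z1; have Z4 := conn_rot4 Z3; have Z5 := conn_rot4 Z4;
  have Z6 := conn_rot4 Z5.
have U0 := conn_pppp R; have U1 := conn_pppm R.
have U2 := conn_rot4 U1; have U3 := conn_rot4 U2; have U4 := conn_rot4 U3.
have V0 := conn_mirror4 U0; have V1 := conn_mirror4 U1; have V2 := conn_mirror4 U2.
have V3 := conn_mirror4 U3; have V4 := conn_mirror4 U4.
rewrite !opprK in V0 V1 V2 V3 V4.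
move=> hk hs [S0 S1 SN]; rewrite -[s]q4_eta.
case: hk => [k0|[k1|kN]].
- rewrite /product_sign k0 eqxx; have := S0 k0; rewrite /sign_sum.
  by case: (hs 0) => ->; case: (hs 1) => ->; case: (hs 2) => ->; case: (hs 3) => ->.
- rewrite /product_sign k1 /=; have := S1 k1; rewrite /sign_sum.
  by case: (hs 0) => ->; case: (hs 1) => ->; case: (hs 2) => ->; case: (hs 3) => ->.
- rewrite /product_sign kN /=; have := SN kN; rewrite /sign_sum.
  by case: (hs 0) => ->; case: (hs 1) => ->; case: (hs 2) => ->; case: (hs 3) => ->.
Qed.

Lemma card_ord4 (P : pred 'I_4) : #|[pred i | P i]| = (P 0%R + P 1%R + P 2%R + P 3%R)%N.
Proof.
rewrite cardE /enum_mem size_filter -enumT enum_ord4 /= !addnA addn0.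
by [].
Qed.

Theorem theorem1p3 (R : realType) (s : 'I_4 -> int)
    (hs : forall i, s i = 1 \/ s i = -1) :
  [/\ [set: moduli R 0 s] !=set0 <->
        #|[pred i | s i == -1]| = 2%N /\ #|[pred i | s i == 1]| = 2%N,
      [set: moduli R 1 s] !=set0 <-> (#|[pred i | s i == (-1)%R]| <= 1)%N,
      [set: moduli R (-1) s] !=set0 <-> (#|[pred i | s i == 1%R]| <= 1)%N
    & forall k : int, k = 0 \/ k = 1 \/ k = -1 ->
        [set: moduli R k s] !=set0 -> connected [set: moduli R k s] ].
Proof.
have main k : k = 0 \/ k = 1 \/ k = -1 -> sign_class k s ->
    [set: moduli R k s] !=set0 /\ connected [set: moduli R k s].
  by move=> hk S; apply: moduli_conn => //; exact: conn_signs.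
have ne k : k = 0 \/ k = 1 \/ k = -1 -> [set: moduli R k s] !=set0 <-> sign_class k s.
  by move=> hk; split; [exact: moduli_nonempty_signs|move=> /(main _ hk)[]].
split.
- rewrite ne; last by left.
  rewrite !card_ord4 /sign_class /sign_sum.
  case: (hs 0) => ->; case: (hs 1) => ->; case: (hs 2) => ->; case: (hs 3) => -> /=;
    by split=> [[] /(_ erefl)|[]].
- rewrite ne; last by right; left.
  rewrite !card_ord4 /sign_class /sign_sum.
  case: (hs 0) => ->; case: (hs 1) => ->; case: (hs 2) => ->; case: (hs 3) => -> /=;
    by split=> [[_ /(_ erefl)]|].
- rewrite ne; last by right; right.
  rewrite !card_ord4 /sign_class /sign_sum.
  case: (hs 0) => ->; case: (hs 1) => ->; case: (hs 2) => ->; case: (hs 3) => -> /=;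
    by split=> [[_ _ /(_ erefl)]|].
- by move=> k hk /ne-/(_ hk) /(main _ hk) [].
Qed.
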